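(* Let $d \ge 2$ be an integer, $0< s \le 1$, $1<\gamma<+\infty$, $1\le p, q < + \infty$, $0 <\alpha\le 1$, and $0< \beta_1, \beta_2 < + \infty$ be such that $$\beta_1p+2\beta_2q =1 \quad\text{and}\quad (d-sp)\beta_1+(d+\alpha)\beta_2 = \frac{d}{\gamma},$$ and $p(d+\alpha)-2q(d-sp)\neq 0$. Assume that $$\beta_1 \gamma + \beta_2 \gamma < 1.$$ Then there is no constant $C>0$ such that the inequality $$\| g\|_{L^\gamma(\mathbb{R}^d)} \leq C\, \| g\|_{\dot W^{s, p}(\mathbb{R}^d)}^{\beta_1 p} \left(\int_{\mathbb{R}^d}\int_{\mathbb{R}^d} \frac{|g(x)|^q|g(y)|^q}{|x-y|^{d-\alpha}}\,dx\,dy\right)^{\beta_2}$$ holds for all $g \in C^1_{c,\mathrm{rad}}(\mathbb{R}^d)$.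
   Context: $C^1_{c,\mathrm{rad}}(\mathbb{R}^d)$ denotes the space of all radial, continuously differentiable, compactly supported functions on $\mathbb{R}^d$. The notation $\|g\|_{\dot W^{s,p}(\mathbb{R}^d)}$ means $\left(\int_{\mathbb{R}^d}\int_{\mathbb{R}^d} \frac{|g(x)-g(y)|^p}{|x-y|^{d+sp}}\,dx\,dy\right)^{1/p}$ if $0<s<1$, and $\left(\int_{\mathbb{R}^d}|\nabla g(x)|^p\,dx\right)^{1/p}$ if $s=1$. *)

(* Defs.v *)
From HB Require Import structures.
From mathcomp Require Import all_boot all_order all_algebra.
From mathcomp Require Import all_classical all_reals all_analysis.

Set Implicit Arguments.
Unset Strict Implicit.
Unset Printing Implicit Defensive.

Import Order.TTheory GRing.Theory Num.Theory.
Import numFieldNormedType.Exports.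

Local Open Scope classical_set_scope.
Local Open Scope ring_scope.

(* R^d is 'rV[R]_d.  The library has neither a sigma-algebra nor Lebesgue
   measure on it: both are built here.  The sigma-algebra is the product one, generated by the
   coordinates, as the library does for tuples; since R is second countable it
   is the Borel sigma-algebra. *)

Definition measure_rV_display : measure_display.
Proof. exact: (measure_tuple_display default_measure_display). Qed.

Section measurable_rV.
Context {R : realType} (d : nat).

Let coords : 'I_d -> 'rV[R]_d -> measurableTypeR R := fun i x => x ord0 i.

Let rV_set0 : g_sigma_preimage coords set0.
Proof. exact: sigma_algebra0. Qed.

Let rV_setC A : g_sigma_preimage coords A -> g_sigma_preimage coords (~` A).
Proof. exact: sigma_algebraC. Qed.

Let rV_bigcup (F : (set 'rV[R]_d)^nat) :
  (forall i, g_sigma_preimage coords (F i)) ->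
  g_sigma_preimage coords (\bigcup_i (F i)).
Proof. exact: sigma_algebra_bigcup. Qed.

HB.instance Definition _ := @isMeasurable.Build measure_rV_display
  'rV[R]_d (g_sigma_preimage coords) rV_set0 rV_setC rV_bigcup.

End measurable_rV.

Section measurable_rV_lemmas.
Context {R : realType}.

Lemma measurable_coord d (i : 'I_d) :
  measurable_fun [set: 'rV[R]_d] (fun x => x ord0 i : measurableTypeR R).
Proof.
move=> _ Y mY; rewrite setTI; apply: sub_sigma_algebra => /=.
rewrite -bigcup_seq/=; exists i => /=; first by rewrite mem_index_enum.
by exists Y => //; rewrite setTI.
Qed.

Lemma measurable_fun_rV {disp} {T : measurableType disp} d (f : T -> 'rV[R]_d) :
  (forall i, measurable_fun [set: T] (fun t => f t ord0 i : measurableTypeR R)) ->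
  measurable_fun [set: T] f.
Proof.
move=> mf _ Y mY; rewrite setTI.
pose S : set (set 'rV[R]_d) := [set A | measurable (f @^-1` A)].
suff : measurable `<=` S by apply.
apply: smallest_sub.
  split.
  - by rewrite /S/= preimage_set0.
  - by move=> A SA; rewrite /S/= setTD preimage_setC; apply: measurableC; exact: SA.
  - by move=> F SF; rewrite /S/= preimage_bigcup; by apply: bigcupT_measurable => n; exact: SF.
rewrite -bigcup_seq => A [i _ [B mB <-]].
rewrite /S/= setTI.
by have := mf i measurableT B mB; rewrite setTI.
Qed.

Definition cons_rV d (p : measurableTypeR R * 'rV[R]_d) : 'rV[R]_d.+1 :=
  \row_i (if unlift ord0 i is Some j then p.2 ord0 j else p.1).

Definition uncons_rV d (x : 'rV[R]_d.+1) : measurableTypeR R * 'rV[R]_d :=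
  (x ord0 ord0, \row_i x ord0 (lift ord0 i)).

Lemma cons_rV0 d p : @cons_rV d p ord0 ord0 = p.1.
Proof. by rewrite mxE unlift_none. Qed.

Lemma cons_rVS d p (i : 'I_d) : cons_rV p ord0 (lift ord0 i) = p.2 ord0 i.
Proof. by rewrite mxE liftK. Qed.

Lemma cons_rVK d : cancel (@cons_rV d) (@uncons_rV d).
Proof.
move=> [t x]; rewrite /uncons_rV cons_rV0; congr pair.
by apply/rowP => i; rewrite mxE cons_rVS.
Qed.

Lemma uncons_rVK d : cancel (@uncons_rV d) (@cons_rV d).
Proof.
move=> x; apply/rowP => i.
case: (unliftP ord0 i) => [j|] ->; last by rewrite cons_rV0.
by rewrite cons_rVS mxE.
Qed.

Lemma measurable_cons_rV d : measurable_fun setT (@cons_rV d).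
Proof.
apply: measurable_fun_rV => i; case: (unliftP ord0 i) => [j|] ->.
  under eq_fun do rewrite cons_rVS.
  exact: measurableT_comp (measurable_coord j) measurable_snd.
under eq_fun do rewrite cons_rV0.
exact: measurable_fst.
Qed.

Lemma measurable_uncons_rV d : measurable_fun setT (@uncons_rV d).
Proof.
apply/measurable_fun_pair; first exact: measurable_coord.
apply: measurable_fun_rV => i /=.
under eq_fun do rewrite mxE.
exact: measurable_coord.
Qed.

End measurable_rV_lemmas.

Section lebesgue_measure_rV.
Context {R : realType}.
Local Open Scope ereal_scope.

Definition lebesgue_rVS d (mu : {sigma_finite_measure set 'rV[R]_d -> \bar R}) :
  set 'rV[R]_d.+1 -> \bar R :=
  pushforward (lebesgue_measure \x mu) (@cons_rV R d).

Section lebesgue_rVS.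
Variables (d : nat) (mu : {sigma_finite_measure set 'rV[R]_d -> \bar R}).

Let rVS0 : lebesgue_rVS mu set0 = 0.
Proof. by rewrite /lebesgue_rVS /pushforward preimage_set0 measure0. Qed.

Let rVS_ge0 A : 0 <= lebesgue_rVS mu A.
Proof. by rewrite /lebesgue_rVS /pushforward measure_ge0. Qed.

Let rVS_sigma_additive : semi_sigma_additive (lebesgue_rVS mu).
Proof.
move=> F mF tF mUF; rewrite /lebesgue_rVS /pushforward preimage_bigcup.
apply: measure_semi_sigma_additive.
- by move=> n; rewrite -[X in measurable X]setTI; exact: measurable_cons_rV.
- apply/trivIsetP => /= i j _ _ ij; rewrite -preimage_setI.
  by move/trivIsetP : tF => /(_ _ _ _ _ ij) ->//; rewrite preimage_set0.
- rewrite -preimage_bigcup -[X in measurable X]setTI.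
  exact: measurable_cons_rV.
Qed.

HB.instance Definition _ := isMeasure.Build _ _ _
  (lebesgue_rVS mu) rVS0 rVS_ge0 rVS_sigma_additive.

Let rVS_sigma_finite : sigma_finite setT (lebesgue_rVS mu).
Proof.
have /sigma_finiteP[F [TF ndF Foo]] := sigma_finiteT (@lebesgue_measure R).
have /sigma_finiteP[G [TG ndG Goo]] := sigma_finiteT mu.
exists (fun n => @uncons_rV R d @^-1` (F n `*` G n)).
  apply/esym; rewrite -subTset => x _.
  have [n _ Fn] : (\bigcup_n F n) (uncons_rV x).1 by rewrite -TF.
  have [k _ Gk] : (\bigcup_n G n) (uncons_rV x).2 by rewrite -TG.
  exists (maxn n k) => //; split => /=.
  - by move: Fn; exact/subsetPset/ndF/leq_maxl.
  - by move: Gk; exact/subsetPset/ndG/leq_maxr.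
move=> n; have [mF Foon] := Foo n; have [mG Goon] := Goo n; split.
  rewrite -[X in measurable X]setTI; apply: measurable_uncons_rV => //.
  exact: measurableX.
rewrite /lebesgue_rVS /pushforward -comp_preimage.
rewrite (_ : _ \o _ = id); last by apply/funext => p /=; rewrite cons_rVK.
by rewrite preimage_id product_measure1E// lte_mul_pinfty// ge0_fin_numE.
Qed.

HB.instance Definition _ := Measure_isSigmaFinite.Build _ _ _
  (lebesgue_rVS mu) rVS_sigma_finite.

End lebesgue_rVS.

(* The d-fold product of the Lebesgue measure of R; R^0 is a point of mass 1. *)
Fixpoint lebesgue_rV (d : nat) : {sigma_finite_measure set 'rV[R]_d -> \bar R} :=
  match d with
  | 0%N => dirac (0%R : 'rV[R]_0)
  | n.+1 => lebesgue_rVS (lebesgue_rV n)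
  end.

Lemma lebesgue_rV_box d (a b : 'rV[R]_d) : (forall i, a ord0 i <= b ord0 i)%R ->
  lebesgue_rV d [set x | forall i, x ord0 i \in `]a ord0 i, b ord0 i]] =
  (\prod_(i < d) (b ord0 i - a ord0 i))%:E.
Proof.
elim: d a b => [|d IH] a b ab.
  rewrite big_ord0 /= diracE mem_set//; by case.
rewrite big_ord_recl EFinM.
set a' := (uncons_rV a).2; set b' := (uncons_rV b).2.
have a'E i : a' ord0 i = a ord0 (lift ord0 i).
  by rewrite -cons_rVS -[in RHS](uncons_rVK a) !cons_rVS.
have b'E i : b' ord0 i = b ord0 (lift ord0 i).
  by rewrite -cons_rVS -[in RHS](uncons_rVK b) !cons_rVS.
under eq_bigr do rewrite -a'E -b'E.
rewrite -IH; last by move=> i; rewrite a'E b'E.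
pose B := [set x : 'rV[R]_d | forall i, x ord0 i \in `]a' ord0 i, b' ord0 i]].
pose I := `]a ord0 ord0, b ord0 ord0]%classic : set (measurableTypeR R).
transitivity ((lebesgue_measure \x lebesgue_rV d) (I `*` B)).
  rewrite /lebesgue_rV -/lebesgue_rV /lebesgue_rVS /pushforward.
  congr (product_measure1 _ _ _).
  apply/seteqP; split => [p/= Ap|p/= [p1 p2] i].
    split; first by have := Ap ord0; rewrite cons_rV0.
    by move=> i; have := Ap (lift ord0 i); rewrite cons_rVS a'E b'E.
  case: (unliftP ord0 i) => [j|] ->; last by rewrite cons_rV0.
  by rewrite cons_rVS; have := p2 j; rewrite a'E b'E.
have mB : measurable B.
  rewrite (_ : B = \bigcap_(i in [set: 'I_d])
      ((fun x => x ord0 i) @^-1` `]a' ord0 i, b' ord0 i]%classic)); last first.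
    by apply/seteqP; split=> [x Bx i _|x Bx i]; [exact: Bx|exact: (Bx i)].
  apply: fin_bigcap_measurable => // i _; rewrite -[X in measurable X]setTI.
  exact: measurable_coord.
have mI : measurable I by exact: measurable_itv.
rewrite product_measure1E//; congr (_ * _).
rewrite [LHS]lebesgue_measure_itv/= lte_fin EFinB.
case: ltgtP (ab ord0) => // ->; by rewrite subee.
Qed.

End lebesgue_measure_rV.

Section coulomb_sobolev.
Context {R : realType} (d : nat).
Implicit Types (x y : 'rV[R]_d) (g : 'rV[R]_d -> R).

(* The library's norm on 'rV[R]_d is the sup norm. *)
Definition enorm x : R := Num.sqrt (\sum_(i < d) x ord0 i ^+ 2).

Definition gradient g x : 'rV[R]_d := \row_(i < d) 'D_(delta_mx ord0 i) g x.

Definition continuously_differentiable g :=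
  (forall x, differentiable g x) /\ continuous (gradient g).

Definition compactly_supported g := compact (closure [set x | g x != 0]).

Definition radial g := forall x y, enorm x = enorm y -> g x = g y.

Definition C1c_rad g :=
  [/\ radial g, continuously_differentiable g & compactly_supported g].

Local Notation mu := (lebesgue_rV d).

(* On the null set x = y the integrand is t / 0 = 0 by convention. *)
Definition gagliardo_seminorm (s p : R) g : \bar R :=
  ((\int[mu]_x \int[mu]_y
     (`|g x - g y| `^ p / enorm (x - y) `^ (d%:R + s * p))%:E) `^ p^-1)%E.

Definition gradient_seminorm (p : R) g : \bar R :=
  ((\int[mu]_x (enorm (gradient g x) `^ p)%:E) `^ p^-1)%E.

(* ||g||_{\dot W^{s,p}}, meaningful for 0 < s <= 1. *)
Definition sobolev_seminorm (s p : R) g : \bar R :=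
  if s == 1 then gradient_seminorm p g else gagliardo_seminorm s p g.

Definition coulomb_energy (alpha q : R) g : \bar R :=
  (\int[mu]_x \int[mu]_y
     (`|g x| `^ q * `|g y| `^ q / enorm (x - y) `^ (d%:R - alpha))%:E)%E.

End coulomb_sobolev.

(* Main.v *)
Require Import Defs.
From HB Require Import structures.
From mathcomp Require Import all_boot all_order all_algebra.
From mathcomp Require Import all_classical all_reals all_analysis.
From mathcomp Require Import measurable_realfun.
From mathcomp Require Import ring lra.

(* The inequality is tested on smooth indicators of the spherical shells of
   radius r and thickness about 1.  Such a function has size 1 on a set of
   measure about r^(d-1), so the powers ||g||_gamma^gamma and
   ||g||_{W^{s,p}}^p are of order r^(d-1).  The ball of radius e around a point
   of the shell meets it in measure at most C e^(d-1), whence the Coulomb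
   energy is at most C r^(d-1) times the sum over the dyadic scales 1 <= e <= 4r
   of e^(alpha-1), that is at most C r^(d-1) log r since alpha <= 1.  The
   inequality would thus give
   r^((d-1)/gamma) <= C r^((d-1)(beta1+beta2)) (log r)^beta2 for all large r,
   which fails because beta1 + beta2 < 1/gamma. *)

Set Implicit Arguments.
Unset Strict Implicit.
Unset Printing Implicit Defensive.

Import Order.TTheory GRing.Theory Num.Theory.
Import numFieldNormedType.Exports.

Local Open Scope classical_set_scope.
Local Open Scope ring_scope.

(** * Slicing the Lebesgue measure *)

(** The crux is the bound e^(d-1) for the part of the shell in a ball of radius e >= 1: it must be
    uniform in r and in the centre, so the shell has to be seen as a hypersurface. Slicing gives
    this without spherical coordinates: shell and cube together have measure at most the length of
    the fibres times the area of a face, once the fibres run in a direction transverse to the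
    sphere. At scales below 1 the plain volume e^d suffices: against the kernels it leaves geometric
    series of ratio 2^(-alpha) and, for the Lipschitz difference with s < 1, 2^(-(p-sp)). The far
    part of the Gagliardo integral has ratio 2^(-sp) without any geometry of the shell. Only the far
    Coulomb part can be borderline: at alpha = 1 all scales weigh the same, and r = 2^n turns log r
    into their number. In these estimates the dimension is [d.+1], so that [r ^+ d] is the order of
    the measure of the shell. *)

Section integral_bounds.
Local Open Scope ereal_scope.
Context {disp} {T : measurableType disp} {R : realType}.
Variable mu : {measure set T -> \bar R}.

(* Contrary to [ge0_le_integral], no measurability is required. *)
Lemma le_integral_nonmeas (f g : T -> \bar R) :
  (forall x, 0 <= f x) -> (forall x, f x <= g x) ->
  \int[mu]_x f x <= \int[mu]_x g x.
Proof.
move=> f0 fg.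
have g0 x : 0 <= g x by exact: le_trans (f0 x) (fg x).
rewrite !ge0_integralTE//; apply: le_ereal_sup => _ [h hf <-].
by exists h => // x; exact: le_trans (hf x) (fg x).
Qed.

Lemma integral_cst_indic (A : set T) (c : R) : measurable A -> (0 <= c)%R ->
  \int[mu]_x (c * \1_A x)%:E = c%:E * mu A.
Proof.
move=> mA c0; under eq_integral do rewrite EFinM.
rewrite ge0_integralZl_EFin//.
- by rewrite integral_indic// setIT.
- by apply/measurable_EFinP/measurable_indicP.
Qed.

End integral_bounds.

Section fibres.
Local Open Scope ereal_scope.
Context {R : realType}.

Definition upd d (i : 'I_d) (t : R) (x : 'rV[R]_d) : 'rV[R]_d :=
  \row_j (if j == i then t else x ord0 j).

Lemma upd_cons0 d (t s : R) (y : 'rV[R]_d) :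
  upd ord0 t (cons_rV (s, y)) = cons_rV (t, y).
Proof.
apply/rowP => j; rewrite mxE; case: (unliftP ord0 j) => [k|] ->.
  by rewrite !cons_rVS eq_sym (negbTE (neq_lift _ _)).
by rewrite eqxx cons_rV0.
Qed.

Lemma upd_consS d (i : 'I_d) (t s : R) (y : 'rV[R]_d) :
  upd (lift ord0 i) t (cons_rV (s, y)) = cons_rV (s, upd i t y).
Proof.
apply/rowP => j; rewrite mxE; case: (unliftP ord0 j) => [k|] ->.
  by rewrite !cons_rVS /= mxE (inj_eq (lift_inj)).
by rewrite !cons_rV0 (negbTE (neq_lift _ _)).
Qed.

Definition cube d (a : 'rV[R]_d) (l : R) : set 'rV[R]_d :=
  [set x | forall i, x ord0 i \in `]a ord0 i, a ord0 i + l]%R].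

Lemma measurable_cube d (a : 'rV[R]_d) l : measurable (cube a l).
Proof.
rewrite (_ : cube a l = \bigcap_(i in [set: 'I_d])
   ((fun x => x ord0 i) @^-1` `]a ord0 i, (a ord0 i + l)%R]%classic)); last first.
  by apply/seteqP; split=> [x Bx i _|x Bx i]; [exact: Bx|exact: (Bx i)].
apply: fin_bigcap_measurable => // i _; rewrite -[X in measurable X]setTI.
exact: measurable_coord.
Qed.

Lemma lebesgue_rV_cube d (a : 'rV[R]_d) l : (0 <= l)%R ->
  lebesgue_rV d (cube a l) = (l ^+ d)%:E.
Proof.
move=> l0; pose b : 'rV[R]_d := \row_i (a ord0 i + l)%R.
have bE i : b ord0 i = (a ord0 i + l)%R by rewrite mxE.
have -> : cube a l = [set x | forall i, x ord0 i \in `]a ord0 i, b ord0 i]%R].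
  by apply/seteqP; split=> x /= Ax i; have := Ax i; rewrite bE.
rewrite lebesgue_rV_box; last by move=> i; rewrite bE lerDl.
rewrite (eq_bigr (fun=> l)); last by move=> i _; rewrite bE addrAC subrr add0r.
by rewrite prodr_const card_ord.
Qed.

Lemma measurable_preimage_cons d (A : set 'rV[R]_d.+1) : measurable A ->
  measurable (@cons_rV R d @^-1` A).
Proof. by move=> mA; rewrite -[X in measurable X]setTI; exact: measurable_cons_rV. Qed.

Lemma lebesgue_rVSx d (A : set 'rV[R]_d.+1) :
  lebesgue_rV d.+1 A =
  \int[lebesgue_measure]_t lebesgue_rV d [set y | A (cons_rV (t, y))].
Proof.
rewrite /= /lebesgue_rVS /pushforward /product_measure1; apply: eq_integral => t _ /=.
by congr (lebesgue_rV d _); apply/seteqP; split=> y; rewrite /xsection/= inE.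
Qed.

(** [lebesgue_rVSx] only unfolds the product measure; this order of slicing is Tonelli's theorem,
    hence the measurability. *)
Lemma lebesgue_rVSy d (A : set 'rV[R]_d.+1) : measurable A ->
  lebesgue_rV d.+1 A =
  \int[lebesgue_rV d]_y lebesgue_measure [set t | A (cons_rV (t, y))].
Proof.
move=> mA; have mB := @measurable_preimage_cons _ _ mA.
have := indic_fubini_tonelli (@lebesgue_measure R) (lebesgue_rV d) mB.
rewrite indic_fubini_tonelli_FE// indic_fubini_tonelli_GE//= => E.
rewrite /lebesgue_rVS /pushforward /product_measure1 E.
apply: eq_integral => y _ /=.
by congr (lebesgue_measure _); apply/seteqP; split=> t; rewrite /ysection/= inE.
Qed.

Lemma fibre0_measure_le d (A : set 'rV[R]_d.+1) (a : 'rV[R]_d.+1) (c l : R) :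
  measurable A -> (0 <= c)%R -> (0 <= l)%R ->
  (forall x, A x -> forall j, j != ord0 ->
     x ord0 j \in `]a ord0 j, a ord0 j + l]%R) ->
  (forall x, lebesgue_measure [set t | A (upd ord0 t x)] <= c%:E) ->
  lebesgue_rV d.+1 A <= (c * l ^+ d)%:E.
Proof.
move=> mA c0 l0 Aa Ac; rewrite lebesgue_rVSy//.
pose a' := (uncons_rV a).2.
have a'E j : a' ord0 j = a ord0 (lift ord0 j) by rewrite /a' /= mxE.
rewrite EFinM -(@lebesgue_rV_cube d a')// -integral_cst_indic//; last first.
  exact: measurable_cube.
apply: le_integral_nonmeas => y; first exact: measure_ge0.
rewrite indicE; case: (boolP (y \in _)) => [_|/negP].
  rewrite mulr1; have := Ac (cons_rV (0%R, y)).
  by under eq_set do rewrite upd_cons0.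
rewrite inE => ny; rewrite mulr0.
rewrite (_ : [set _ | _] = set0) ?measure0//.
apply/seteqP; split=> // t /= At; apply: ny => j; rewrite a'E.
by have := Aa _ At (lift ord0 j); rewrite cons_rVS; apply; rewrite eq_sym neq_lift.
Qed.

(** The measure is built by adjoining a coordinate in front, so only direction 0 can be sliced off
    directly. For another direction, coordinate 0 is frozen, the bound in one dimension less applies
    to each slice, and the outer integral over an interval of length [l] supplies the missing
    factor. *)
Lemma fibre_measure_le d (i : 'I_d.+1) (A : set 'rV[R]_d.+1)
    (a : 'rV[R]_d.+1) (c l : R) :
  measurable A -> (0 <= c)%R -> (0 <= l)%R ->
  (forall x, A x -> forall j, j != i ->
     x ord0 j \in `]a ord0 j, a ord0 j + l]%R) ->
  (forall x, lebesgue_measure [set t | A (upd i t x)] <= c%:E) ->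
  lebesgue_rV d.+1 A <= (c * l ^+ d)%:E.
Proof.
elim: d i A a => [|d IH] i A a mA c0 l0 Aa Ac.
  by rewrite (ord1 i) in Aa Ac *; exact: (@fibre0_measure_le _ _ a).
move: Aa Ac; case: (unliftP ord0 i) => [k|] -> Aa Ac; last first.
  exact: (@fibre0_measure_le _ _ a).
rewrite lebesgue_rVSx.
pose a' := (uncons_rV a).2.
have a'E j : a' ord0 j = a ord0 (lift ord0 j) by rewrite /a' /= mxE.
pose I := `]a ord0 ord0, (a ord0 ord0 + l)%R]%classic : set (measurableTypeR R).
have -> : (c * l ^+ d.+1)%:E = (c * l ^+ d)%:E * lebesgue_measure I.
  rewrite lebesgue_measure_itv/= lte_fin.
  move: l0; rewrite le_eqVlt => /predU1P[<-|l1].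
    by rewrite addr0 ltxx mule0 expr0n/= mulr0.
  by rewrite ltrDl l1 -EFinD -EFinM addrAC subrr add0r exprSr mulrA.
have mI : measurable I by exact: measurable_itv.
rewrite -integral_cst_indic//; last by rewrite mulr_ge0// exprn_ge0.
apply: le_integral_nonmeas => t; first exact: measure_ge0.
rewrite indicE; case: (boolP (t \in _)) => [_|/negP].
  rewrite mulr1; apply: (IH k _ a') => //.
  - have mB := @measurable_preimage_cons _ _ mA.
    have := @measurable_xsection _ _ _ _ _ t mB.
    by congr measurable; apply/seteqP; split=> y; rewrite /xsection/= inE.
  - move=> y /= Ay j jk; rewrite a'E.
    by have := Aa _ Ay (lift ord0 j); rewrite cons_rVS; apply; rewrite (inj_eq lift_inj).
  - move=> y /=; have := Ac (cons_rV (t, y)).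
    by under eq_set do rewrite upd_consS.
rewrite inE => nt; rewrite mulr0 (_ : [set _ | _] = set0) ?measure0//.
apply/seteqP; split=> // y /= At; apply: nt.
by have := Aa _ At ord0; rewrite cons_rV0; apply; rewrite neq_lift.
Qed.

Lemma fibre0_measure_ge d (A : set 'rV[R]_d.+1) (a : 'rV[R]_d) (c l : R) :
  measurable A -> (0 <= c)%R -> (0 <= l)%R ->
  (forall y, cube a l y ->
     c%:E <= lebesgue_measure [set t | A (cons_rV (t, y))]) ->
  (c * l ^+ d)%:E <= lebesgue_rV d.+1 A.
Proof.
move=> mA c0 l0 Ac; rewrite lebesgue_rVSy//.
rewrite EFinM -(@lebesgue_rV_cube d a)// -integral_cst_indic//; last first.
  exact: measurable_cube.
apply: le_integral_nonmeas => y; first by rewrite lee_fin mulr_ge0.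
rewrite indicE; case: (boolP (y \in _)) => [|_]; last by rewrite mulr0 measure_ge0.
by rewrite inE mulr1 => /Ac.
Qed.

End fibres.

(** * Double integrals by dyadic decomposition of the distance *)

Section sup_norm.
Context {R : realType}.

Lemma norm_rV_leP d (x : 'rV[R]_d) (r : R) : 0 <= r ->
  reflect (forall i, `|x ord0 i| <= r) (`|x| <= r).
Proof.
move=> r0; rewrite [`|x|]/Num.norm/= mx_normrE; apply: (iffP (bigmax_leP _ _ _ _)).
  by move=> [_ xr] i; exact: (xr (ord0, i)).
by move=> xr; split=> // -[i j] _ /=; rewrite (ord1 i).
Qed.

Lemma norm_rV_coord d (x : 'rV[R]_d) i : `|x ord0 i| <= `|x|.
Proof. by apply/norm_rV_leP. Qed.

Lemma sum_sqr_coord_le d (x : 'rV[R]_d) (r : R) : 0 <= r -> (forall i, `|x ord0 i| <= r) ->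
  \sum_(i < d) x ord0 i ^+ 2 <= d%:R * r ^+ 2.
Proof.
move=> r0 xr; rewrite mulr_natl -[X in _ *+ X]card_ord -sumr_const.
by apply: ler_sum => i _; rewrite -real_normK ?num_real// lerXn2r ?nnegrE.
Qed.

Lemma norm_le_enorm d (x : 'rV[R]_d) : `|x| <= enorm x.
Proof.
apply/norm_rV_leP => [|i]; first exact: sqrtr_ge0.
rewrite -sqrtr_sqr ler_wsqrtr// (bigD1 i)//= lerDl.
by apply: sumr_ge0 => j _; exact: sqr_ge0.
Qed.

Lemma enorm_le d (x : 'rV[R]_d) (r : R) : 0 <= r -> (forall i, `|x ord0 i| <= r) ->
  enorm x <= d%:R * r.
Proof.
move=> r0 xr; rewrite -(ger0_norm (_ : 0 <= d%:R * r)) ?mulr_ge0//.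
rewrite -sqrtr_sqr ler_wsqrtr//; apply: le_trans (sum_sqr_coord_le r0 xr) _.
rewrite exprMn ler_wpM2r ?sqr_ge0// -natrX ler_nat.
by case: d {x xr} => // d; rewrite leq_pmulr.
Qed.

Lemma dyadicP (t : R) : 1 <= t -> exists k, 2 ^+ k <= t <= 2 ^+ k.+1.
Proof.
move=> t1; have ex : exists n, t < 2 ^+ n.
  exists (Num.truncn t).+1; apply: lt_le_trans (truncnS_gt _) _.
  by rewrite -natrX ler_nat ltnW// ltn_expl.
case: (ex_minnP ex) => -[|k] tk kmin; first by move: (lt_le_trans tk t1); rewrite ltxx.
exists k; rewrite (ltW tk) andbT leNgt; apply/negP => /kmin.
by rewrite ltnn.
Qed.

Lemma dyadic_invP (t : R) : 0 < t <= 1 -> exists k, 2^-1 ^+ k.+1 <= t <= 2^-1 ^+ k.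
Proof.
move=> /andP[t0 t1]; have [k /andP[kt tk]] : exists k, 2 ^+ k <= t^-1 <= 2 ^+ k.+1.
  by apply: dyadicP; rewrite invf_ge1.
exists k; rewrite !exprVn.
rewrite -[t]invrK !lef_pV2 ?posrE ?invr_gt0 ?exprn_gt0//.
by rewrite kt tk.
Qed.

End sup_norm.

Section double_integrals.
Local Open Scope ereal_scope.
Context {R : realType} (d : nat).
Local Notation E := ('rV[R]_d).
Local Notation mu := (lebesgue_rV (R:=R) d).

(** The sup norm puts the sections in cubes, whose measure is explicit. The Euclidean distance in
    the kernels dominates it by [norm_le_enorm], the direction needed for upper bounds. *)
Definition band (r : R) : set (E * E) := [set z | (`|z.1 - z.2| <= r)%R].

Lemma measurable_band r : measurable (band r).
Proof.
have [r0|r0] := leP 0%R r; last first.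
  rewrite (_ : band r = set0)//; apply/seteqP; split=> // z /= zr.
  by have := le_lt_trans zr r0; rewrite normr_lt0.
rewrite (_ : band r = \bigcap_(i in [set: 'I_d])
   ((fun z : E * E => (z.1 ord0 i - z.2 ord0 i)%R) @^-1` `[(- r)%R, r]%classic)).
  apply: fin_bigcap_measurable => // i _; rewrite -[X in measurable X]setTI.
  apply: (measurable_funB (f := fun z : E * E => z.1 ord0 i)
    (g := fun z : E * E => z.2 ord0 i)) => //.
  - exact: measurableT_comp (measurable_coord i) measurable_fst.
  - exact: measurableT_comp (measurable_coord i) measurable_snd.
apply/seteqP; split=> z /=.
  by move=> /norm_rV_leP-/(_ r0) zr i _ /=; have := zr i; rewrite !mxE in_itv/= ler_norml.
move=> zr; apply/norm_rV_leP => // i; have := zr i I; rewrite /= !mxE in_itv/=.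
by rewrite ler_norml.
Qed.

Lemma product_lebesgue_swap (B : set (E * E)) : measurable B ->
  (mu \x mu) B = \int[mu]_y mu (ysection B y).
Proof.
move=> mB; have := indic_fubini_tonelli mu mu mB.
by rewrite indic_fubini_tonelli_FE// indic_fubini_tonelli_GE.
Qed.

Lemma product_lebesgue_le1 (B : set (E * E)) (S : set E) (v : R) :
  measurable S -> (0 <= v)%R -> (forall x y, B (x, y) -> S x) ->
  (forall x, S x -> mu (xsection B x) <= v%:E) ->
  (mu \x mu) B <= v%:E * mu S.
Proof.
move=> mS v0 BS Bv; rewrite -integral_cst_indic//.
apply: le_integral_nonmeas => x; first exact: measure_ge0.
rewrite indicE; case: (boolP (x \in S)) => [|/negP]; rewrite inE => Sx.
  by rewrite mulr1 /=; exact: Bv.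
rewrite mulr0 /= (_ : xsection B x = set0) ?measure0//.
by apply/seteqP; split=> // y; rewrite /xsection/= inE => /BS.
Qed.

Lemma product_lebesgue_le2 (B : set (E * E)) (S : set E) (v : R) :
  measurable B -> measurable S -> (0 <= v)%R -> (forall x y, B (x, y) -> S y) ->
  (forall y, S y -> mu (ysection B y) <= v%:E) ->
  (mu \x mu) B <= v%:E * mu S.
Proof.
move=> mB mS v0 BS Bv; rewrite product_lebesgue_swap// -integral_cst_indic//.
apply: le_integral_nonmeas => y; first exact: measure_ge0.
rewrite indicE; case: (boolP (y \in S)) => [|/negP]; rewrite inE => Sy.
  by rewrite mulr1 /=; exact: Bv.
rewrite mulr0 /= (_ : ysection B y = set0) ?measure0//.
by apply/seteqP; split=> // x; rewrite /ysection/= inE => /BS.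
Qed.

(** [H] need not be measurable: it is dominated pointwise by a countable sum of multiples of
    indicators, and Tonelli is applied to that sum only. Each dyadic annulus is enlarged to a full
    band, which costs no more than a constant in the applications. *)
Lemma double_integral_dyadic (H : E -> E -> R) (D : set (E * E)) (a b : nat -> R) :
  measurable D -> (forall x y, 0 <= H x y)%R ->
  (forall k, 0 <= a k)%R -> (forall k, 0 <= b k)%R ->
  (forall x y, H x y != 0%R -> x != y /\ D (x, y)) ->
  (forall k x y, D (x, y) -> 2^-1 ^+ k.+1 <= `|x - y| <= 2^-1 ^+ k -> H x y <= a k)%R ->
  (forall k x y, D (x, y) -> 2 ^+ k <= `|x - y| <= 2 ^+ k.+1 -> H x y <= b k)%R ->
  \int[mu]_x \int[mu]_y (H x y)%:E <=
  \sum_(k <oo) (a k)%:E * (mu \x mu) (D `&` band (2^-1 ^+ k)) +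
  \sum_(k <oo) (b k)%:E * (mu \x mu) (D `&` band (2 ^+ k.+1)).
Proof.
move=> mD H0 a0 b0 HD Ha Hb.
have mDb r : measurable (D `&` band r) by apply: measurableI => //; exact: measurable_band.
pose A k z := (a k * \1_(D `&` band (2^-1 ^+ k)) z)%:E : \bar R.
pose B k z := (b k * \1_(D `&` band (2 ^+ k.+1)) z)%:E : \bar R.
have A0 k z : 0 <= A k z by rewrite lee_fin mulr_ge0.
have B0 k z : 0 <= B k z by rewrite lee_fin mulr_ge0.
have mA k : measurable_fun setT (A k).
  by apply/measurable_EFinP/measurable_funM => //; exact/measurable_indicP.
have mB k : measurable_fun setT (B k).
  by apply/measurable_EFinP/measurable_funM => //; exact/measurable_indicP.
pose F z := \sum_(k <oo) A k z + \sum_(k <oo) B k z.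
have sA0 z : 0 <= \sum_(k <oo) A k z by apply: nneseries_ge0.
have sB0 z : 0 <= \sum_(k <oo) B k z by apply: nneseries_ge0.
have msA : measurable_fun setT (fun z => \sum_(k <oo) A k z).
  exact: ge0_emeasurable_sum.
have msB : measurable_fun setT (fun z => \sum_(k <oo) B k z).
  exact: ge0_emeasurable_sum.
have HF x y : (H x y)%:E <= F (x, y).
  have [H0'|] := eqVneq (H x y) 0%R; first by rewrite H0' adde_ge0.
  move=> /HD[xy Dxy].
  have xy0 : (0 < `|x - y|)%R by rewrite normr_gt0 subr_eq0.
  have [xy1|xy1] := leP `|x - y|%R 1%R.
    have [k /andP[k1 k2]] : exists k, (2^-1 ^+ k.+1 <= `|x - y| <= 2^-1 ^+ k)%R.
      by apply: dyadic_invP; rewrite xy0.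
    apply: le_trans (leeDl _ (sB0 _)).
    apply: (@le_trans _ _ (A k (x, y))).
      by rewrite /A indicE mem_set ?mulr1 ?lee_fin; [apply: Ha; rewrite ?k1|split].
    by rewrite (@nneseriesD1 _ _ k)// leeDl// nneseries_ge0.
  have [k /andP[k1 k2]] : exists k, (2 ^+ k <= `|x - y| <= 2 ^+ k.+1)%R.
    exact/dyadicP/ltW.
  apply: le_trans (leeDr _ (sA0 _)).
  apply: (@le_trans _ _ (B k (x, y))).
    by rewrite /B indicE mem_set ?mulr1 ?lee_fin; [apply: Hb; rewrite ?k1|split].
  by rewrite (@nneseriesD1 _ _ k)// leeDl// nneseries_ge0.
apply: (@le_trans _ _ (\int[mu]_x \int[mu]_y F (x, y))).
  apply: le_integral_nonmeas => x.
    by apply: integral_ge0 => y _; rewrite lee_fin.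
  by apply: le_integral_nonmeas => y; rewrite ?lee_fin.
rewrite -(@fubini_tonelli1 _ _ _ _ _ mu mu F)//; last 2 first.
  exact: emeasurable_funD.
  by move=> z; exact: adde_ge0.
rewrite /F ge0_integralD// !integral_nneseries//.
apply: leeD; apply: lee_nneseries => k *.
- exact: integral_ge0.
- by rewrite /A integral_cst_indic.
- exact: integral_ge0.
- by rewrite /B integral_cst_indic.
Qed.

End double_integrals.

(** * Measure of spherical shells *)

Section shells.
Context {R : realType}.

Definition sqnorm d (x : 'rV[R]_d) : R := \sum_(i < d) x ord0 i ^+ 2.

Lemma sqnorm_ge0 d (x : 'rV[R]_d) : 0 <= sqnorm x.
Proof. by apply: sumr_ge0 => i _; exact: sqr_ge0. Qed.

Lemma sqr_coord_le_sqnorm d (x : 'rV[R]_d) i : x ord0 i ^+ 2 <= sqnorm x.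
Proof.
by rewrite /sqnorm (bigD1 i)//= lerDl; apply: sumr_ge0 => j _; exact: sqr_ge0.
Qed.

Lemma sqnorm_upd d (i : 'I_d) (t : R) (x : 'rV[R]_d) :
  sqnorm (upd i t x) = t ^+ 2 + \sum_(j < d | j != i) x ord0 j ^+ 2.
Proof.
rewrite /sqnorm (bigD1 i)//= mxE eqxx; congr (_ + _).
by apply: eq_bigr => j /negbTE ji; rewrite mxE ji.
Qed.

Lemma sqnorm_cons d (t : R) (y : 'rV[R]_d) :
  sqnorm (cons_rV (t, y)) = t ^+ 2 + sqnorm y.
Proof.
rewrite /sqnorm big_ord_recl cons_rV0; congr (_ + _).
by apply: eq_bigr => j _; rewrite cons_rVS.
Qed.

Lemma measurable_sqnorm d : measurable_fun setT (@sqnorm d).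
Proof.
apply: measurable_sum => i.
by apply: (measurable_funX (f := fun x : 'rV[R]_d => x ord0 i)); exact: measurable_coord.
Qed.

(* The thickness is e for the squared norm, that is about e / r for the norm. *)
Definition shell d (r e : R) : set 'rV[R]_d := [set x | `|sqnorm x - r ^+ 2| <= e].

Lemma measurable_shell d r e : measurable (@shell d r e).
Proof.
rewrite (_ : shell r e = @sqnorm d @^-1` `[r ^+ 2 - e, r ^+ 2 + e]%classic).
  by rewrite -[X in measurable X]setTI; exact: measurable_sqnorm.
by apply/seteqP; split=> x /=; rewrite /shell/= in_itv/= ler_distl.
Qed.

Lemma shell_coord_le d (r : R) (x : 'rV[R]_d) i : 1 <= r -> shell r r x ->
  `|x ord0 i| <= 2 * r.
Proof.
move=> r1 /=; rewrite /shell/= ler_distl => /andP[_ xr].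
have := le_trans (sqr_coord_le_sqnorm x i) xr => xi.
rewrite -ler_sqr ?nnegrE//; last by lra.
rewrite real_normK ?num_real//; nra.
Qed.

Lemma upd_measurable d (i : 'I_d) (x : 'rV[R]_d) :
  measurable_fun setT (fun t : measurableTypeR R => upd i t x).
Proof.
apply: measurable_fun_rV => j; under eq_fun do rewrite mxE.
by case: (j == i); [exact: measurable_id|exact: measurable_cst].
Qed.

(** An interval centred at any point of the set will do. An enclosing set is produced because [P] is
    not assumed measurable. *)
Lemma lebesgue_measure_near_le (A P : set (measurableTypeR R)) (D : R) : 0 <= D ->
  (forall t u, A t -> A u -> P t -> P u -> `|t - u| <= D) ->
  exists2 I : set (measurableTypeR R), measurable I /\ A `&` P `<=` I &
    (lebesgue_measure I <= (2 * D)%:E)%E.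
Proof.
move=> D0 AD; have [[t [At Pt]]|nA] := pselect (exists t, A t /\ P t).
  exists `[t - D, t + D]%classic; first split.
  - exact: measurable_itv.
  - move=> u [Au Pu] /=; rewrite in_itv/= -ler_distl.
    exact: AD.
  - rewrite lebesgue_measure_itv/= lte_fin; case: ifP => _; rewrite lee_fin; lra.
exists set0; last by rewrite measure0 lee_fin; lra.
by split=> // t At; apply: nA; exists t.
Qed.

(** Meant for the fibres of a shell, whose positive and negative parts are each short but may be far
    apart. *)
Lemma lebesgue_measure_two_pieces_le (A : set (measurableTypeR R)) (D : R) :
  measurable A -> 0 <= D ->
  (forall t u, A t -> A u -> 0 <= t -> 0 <= u -> `|t - u| <= D) ->
  (forall t u, A t -> A u -> t <= 0 -> u <= 0 -> `|t - u| <= D) ->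
  (lebesgue_measure A <= (4 * D)%:E)%E.
Proof.
move=> mA D0 Ap An.
have [I [mI AI] lI] := lebesgue_measure_near_le D0 Ap.
have [J [mJ AJ] lJ] := lebesgue_measure_near_le D0 An.
apply: (@le_trans _ _ (lebesgue_measure (I `|` J))).
  apply: le_measure; rewrite ?inE//; first exact: measurableU.
  move=> t At; have [t0|/ltW t0] := leP 0 t; first by left; exact: AI.
  by right; exact: AJ.
apply: le_trans (measureU2 _ mI mJ) _.
rewrite (_ : 4 * D = 2 * D + 2 * D); last by lra.
by rewrite EFinD leeD.
Qed.

(* On this cone the i-th coordinate of a point of the shell is at least
   r / (2 d), so t |-> t^2 has slope of order r there: the fibres of the shell
   in the i-th direction have bounded length.  The d cones cover the space. *)
Definition sector d (i : 'I_d) : set 'rV[R]_d :=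
  [set x | sqnorm x <= d%:R * x ord0 i ^+ 2].

Lemma measurable_sector d (i : 'I_d) : measurable (sector i).
Proof.
rewrite -[X in measurable X]setTI; apply: measurable_fun_le => //.
  exact: measurable_sqnorm.
apply: measurable_funM => //.
by apply: (measurable_funX (f := fun x : 'rV[R]_d => x ord0 i)); exact: measurable_coord.
Qed.

Lemma shell_fibre_measure d (r : R) (i : 'I_d) (x : 'rV[R]_d) : 2 <= r ->
  (lebesgue_measure [set t | (shell r r `&` sector i) (upd i t x)] <= (8 * d%:R)%:E)%E.
Proof.
move=> r2; have d1 : 1 <= d%:R :> R by rewrite ler1n; case: d i {x} => // -[].
set A := [set t | _].
have mA : measurable A.
  have mB : measurable (shell r r `&` sector i).
    by apply: measurableI; [exact: measurable_shell|exact: measurable_sector].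
  have := @upd_measurable _ i x measurableT _ mB.
  by rewrite setTI.
pose s := \sum_(j < d | j != i) x ord0 j ^+ 2.
have AE t : A t -> `|t ^+ 2 + s - r ^+ 2| <= r /\ t ^+ 2 + s <= d%:R * t ^+ 2.
  by rewrite /A/= /shell/sector/= sqnorm_upd mxE eqxx.
(* In the sector, [d * t^2] is at least the squared norm, which is at least [r^2 - r >= r^2 / 2]
   because [r >= 2]. *)
have At t : A t -> r / (2 * d%:R) <= `|t|.
  move=> /AE[]; rewrite ler_distl => /andP[t1 _] t2.
  have d2 : 0 < 2 * d%:R :> R by lra.
  rewrite ler_pdivrMr// -ler_sqr ?nnegrE; [|lra|by rewrite mulr_ge0//; lra].
  rewrite exprMn real_normK ?num_real//.
  have : d%:R * t ^+ 2 <= d%:R ^+ 2 * t ^+ 2 by rewrite ler_wpM2r ?sqr_ge0//; nra.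
  nra.
(* The squares differ by at most [2 * r], while [t + u >= r / d]; dividing bounds the difference. *)
have key (t u : R) : 0 <= t -> 0 <= u -> A t -> A u -> r / (2 * d%:R) <= t ->
    r / (2 * d%:R) <= u -> `|t - u| <= 2 * d%:R.
  move=> t0 u0 /AE[tr _] /AE[ur _] rt ru.
  have d2 : 0 < 2 * d%:R :> R by lra.
  move: tr ur; rewrite !ler_distl => /andP[t1 t2] /andP[u1 u2].
  have p0 : r <= d%:R * (t + u).
    move: rt ru; rewrite !ler_pdivrMr// => rt ru; nra.
  have : `|t - u| * (t + u) <= 2 * r.
    have tu0 : 0 <= t + u by lra.
    rewrite -(ger0_norm tu0) -normrM ler_norml; apply/andP; split; nra.
  move=> tu.
  have tu1 : `|t - u| * r <= `|t - u| * (d%:R * (t + u)) by rewrite ler_wpM2l.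
  have r0 : 0 < r by lra.
  rewrite -ler_distl; suff : `|t - u| * r <= 2 * d%:R * r by rewrite ler_pM2r.
  apply: le_trans tu1 _.
  rewrite mulrCA [2 * _]mulrC -mulrA; apply: ler_wpM2l => //; lra.
rewrite (_ : 8 * d%:R = 4 * (2 * d%:R)); last by lra.
apply: lebesgue_measure_two_pieces_le => // t u tA uA t0 u0.
- apply: key => //; [have := At _ tA|have := At _ uA]; by rewrite ger0_norm.
(* The negative part reduces to the positive one, since shell and sector are invariant under a
   change of sign of the coordinate. *)
- rewrite -normrN opprB -(opprK u) addrC.
  have AN v : A v -> A (- v) by rewrite /A/= /shell/sector/= !sqnorm_upd !mxE !eqxx sqrrN.
  apply: key; rewrite ?oppr_ge0//; try exact: AN.
    by have := At _ tA; rewrite ler0_norm.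
  by have := At _ uA; rewrite ler0_norm.
Qed.

(** The exponent of [l] is one less than the dimension, with a constant free of [r] and [a]. Each of
    the [d.+1] sectors contributes [8 * d.+1] times the area of a face, whence the square. *)
Lemma shell_cube_measure d (r l : R) (a : 'rV[R]_d.+1) : 2 <= r -> 0 <= l ->
  (lebesgue_rV d.+1 (shell r r `&` cube a l) <=
   (8 * d.+1%:R ^+ 2 * l ^+ d)%:E)%E.
Proof.
move=> r2 l0.
pose P (i : 'I_d.+1) : set 'rV[R]_d.+1 :=
  (shell r r `&` sector i) `&` cube a l.
have mP i : measurable (P i).
  apply: measurableI; last exact: measurable_cube.
  by apply: measurableI; [exact: measurable_shell|exact: measurable_sector].
have mS : measurable (shell r r `&` cube a l).
  by apply: measurableI; [exact: measurable_shell|exact: measurable_cube].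
(* Outside all sectors, summing the strict inequalities over [i] would give
   [d.+1 * sqnorm x < d.+1 * sqnorm x]. *)
have PS : shell r r `&` cube a l `<=` \bigcup_(i in [set: 'I_d.+1]) P i.
  move=> x [Sx Qx]; apply: contrapT => nx.
  have lt i : d.+1%:R * x ord0 i ^+ 2 < sqnorm x.
    by rewrite ltNge; apply/negP => xi; apply: nx; exists i.
  have : \sum_(i < d.+1) (d.+1%:R * x ord0 i ^+ 2) < \sum_(i < d.+1) sqnorm x.
    by apply: ltr_sum => //; apply/hasP; exists ord0 => //; rewrite mem_index_enum.
  by rewrite -mulr_sumr sumr_const card_ord -[X in _ < X]mulr_natl ltxx.
apply: le_trans (content_sub_fsum (lebesgue_rV d.+1) finite_finset (fun i _ => mP i) mS PS) _.
rewrite (_ : [set: 'I_d.+1] = [set` index_enum 'I_d.+1]); last first.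
  by apply/seteqP; split=> // i _ /=; exact: mem_index_enum.
rewrite -fsbig_seq ?index_enum_uniq//.
rewrite (_ : 8 * d.+1%:R ^+ 2 * l ^+ d = \sum_(i < d.+1) (8 * d.+1%:R * l ^+ d)); last first.
  by rewrite sumr_const card_ord -[RHS]mulr_natl; ring.
rewrite -sumEFin; apply: lee_sum => i _.
have := fibre_measure_le (i := i) (A := P i) (a := a) (c := 8 * d.+1%:R) (l := l).
apply=> //; first by move=> x [_ xa] j _; exact: xa.
move=> x; apply: le_trans (shell_fibre_measure i x r2).
have mpre (B : set 'rV[R]_d.+1) : measurable B ->
    measurable [set t : measurableTypeR R | B (upd i t x)].
  by move=> mB; have := @upd_measurable _ i x measurableT _ mB; rewrite setTI.
apply: le_measure; rewrite ?inE; first exact: mpre.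
  by apply: mpre; apply: measurableI; [exact: measurable_shell|exact: measurable_sector].
by move=> t [].
Qed.

Lemma shell_measure_le d (r : R) : 2 <= r ->
  (lebesgue_rV d.+1 (shell r r) <= (8 * d.+1%:R ^+ 2 * 8 ^+ d * r ^+ d)%:E)%E.
Proof.
move=> r2; have l0 : 0 <= 8 * r by lra.
(* Coordinates on the shell are at most [2 * r] in absolute value; the larger cube leaves room for
   its open faces. *)
pose a : 'rV[R]_d.+1 := const_mx (- (4 * r)).
have -> : shell r r = shell r r `&` cube a (8 * r) :> set 'rV[R]_d.+1.
  apply/esym/setIidl => x Sx i; rewrite mxE in_itv/=.
  have r1 : 1 <= r by lra.
  by have := shell_coord_le i r1 Sx; rewrite ler_norml => /andP[? ?]; apply/andP; split; lra.
by apply: le_trans (shell_cube_measure a r2 l0) _; rewrite exprMn mulrA.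
Qed.

(** A cap is enough: the part of the shell above a cube of side [r / (2 * d.+1)] in the hyperplane
    of the remaining coordinates. There [sqnorm y <= r^2 / 4], so every line above the cube meets
    the sphere. *)
Lemma shell_measure_ge d (r : R) : 2 <= r ->
  ((8 ^-1 * (2 * d.+1%:R) ^- d * r ^+ d)%:E <= lebesgue_rV d.+1 (shell r (r / 2)))%E.
Proof.
move=> r2; have d1 : 1 <= d.+1%:R :> R by rewrite ler1n.
have d2 : 0 < 2 * d.+1%:R :> R by lra.
pose l := r / (2 * d.+1%:R).
have l0 : 0 <= l by rewrite divr_ge0//; lra.
have -> : 8^-1 * (2 * d.+1%:R) ^- d * r ^+ d = 8^-1 * l ^+ d.
  by rewrite /l expr_div_n -mulrA [_^-1 * r ^+ d]mulrC.
apply: (@fibre0_measure_ge _ _ _ (0 : 'rV[R]_d)) => //; first exact: measurable_shell.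
move=> y Qy.
have sl : sqnorm y <= r ^+ 2 / 4.
  apply: (@le_trans _ _ (d%:R * l ^+ 2)).
    apply: sum_sqr_coord_le => // i.
    have := Qy i; rewrite in_itv/= mxE add0r => /andP[y0 yl].
    by rewrite ger0_norm// ltW.
  rewrite /l expr_div_n mulrA ler_pdivrMr ?exprn_gt0// exprMn.
  have : d%:R <= d.+1%:R ^+ 2 :> R by 
    by rewrite -natrX ler_nat (leq_trans (leqnSn d))// -mulnn leq_pmulr.
  have := sqr_ge0 r; nra.
have s0 := sqnorm_ge0 y.
set s := sqnorm y in sl s0.
(* Height at which the line above [y] crosses the sphere. Climbing by 1/8 raises the squared norm by
   at most [T / 4 + 1 / 64], which is below [r / 2]. *)
pose T := Num.sqrt (r ^+ 2 - s).
have T0 : 0 <= T by exact: sqrtr_ge0.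
have TE : T ^+ 2 = r ^+ 2 - s by rewrite sqr_sqrtr//; nra.
have Tr : T <= r by rewrite -ler_sqr ?nnegrE//; lra.
have mA : measurable [set t : measurableTypeR R | shell r (r / 2) (cons_rV (t, y))].
  have mB := @measurable_preimage_cons _ _ _ (@measurable_shell d.+1 r (r / 2)).
  have := @measurable_ysection _ _ _ _ _ y mB.
  by congr measurable; apply/seteqP; split=> t; rewrite /ysection/= inE.
apply: (@le_trans _ _ (lebesgue_measure `[T, T + 8^-1]%classic)).
  by rewrite lebesgue_measure_itv/= lte_fin ltrDl invr_gt0 ltr0n -EFinD lee_fin; lra.
apply: le_measure; [by rewrite inE; exact: measurable_itv|by rewrite inE|].
move=> t /=; rewrite in_itv/= /shell/= sqnorm_cons -/s => /andP[t1 t2].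
rewrite ler_distl; apply/andP; split; nra.
Qed.

End shells.

(** * The test functions *)

Section shell_bump.
Context {R : realType}.

Lemma continuous_maxr0 : continuous (fun t : R => Num.max 0 t).
Proof.
have -> : (fun t : R => Num.max 0 t) = (fun t => 2^-1 * (t + `|t|)).
  apply/funext => t; case: (leP 0 t) => t0.
    by rewrite ger0_norm//; lra.
  by rewrite ltr0_norm//; lra.
move=> t; apply: cvgM; first exact: cvg_cst.
by apply: cvgD; [exact: cvg_id|exact: norm_continuous].
Qed.

(** Squaring removes the corner: in all four sign cases the difference quotient at step [h] is
    within [|h|] of the claimed derivative. *)
Lemma is_derive_sqr_maxr0 (t : R) :
  is_derive t 1 (fun u => Num.max 0 u ^+ 2) (2 * Num.max 0 t).
Proof.
have H : h^-1 *: (Num.max 0 (h *: (1 : R) + t) ^+ 2 - Num.max 0 t ^+ 2) @[h --> (0:R)^'] -->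
    2 * Num.max 0 t.
  apply/cvgrPdist_le => e e0; near=> h.
  have h0 : h != 0 by near: h; exact: nbhs_dnbhs_neq.
  have he : `|h| <= e.
    by near: h; apply: dnbhs0_le.
  apply: le_trans he; rewrite -(ler_pM2l (_ : 0 < `|h|)) ?normr_gt0//.
  rewrite -normrM mulrBr /GRing.scale/= mulr1 mulVKf//.
  rewrite -expr2 real_normK ?num_real// ler_norml.
  by case: (leP 0 t) => t0; case: (leP 0 (h + t)) => ht0; apply/andP; split; nra.
split; first by apply/cvg_ex; exists (2 * Num.max 0 t).
exact: cvg_lim H.
Unshelve. all: by end_near. Qed.

(** With [u = (t - r^2) / r] this is the square of the positive part of [1 - u^2]: of class C^1 and
    zero for [|u| >= 1]. The variable [t] stands for the squared norm, which is smooth at the origin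
    too. *)
Definition bump_profile (r t : R) : R :=
  Num.max 0 (1 - ((t - r ^+ 2) / r) ^+ 2) ^+ 2.

Definition bump_profile' (r t : R) : R :=
  2 * Num.max 0 (1 - ((t - r ^+ 2) / r) ^+ 2) * - (2 * ((t - r ^+ 2) / r) / r).

Lemma is_derive_bump_profile (r t : R) :
  is_derive t 1 (bump_profile r) (bump_profile' r t).
Proof.
apply: (@is_derive1_comp _ (fun u => Num.max 0 u ^+ 2)
  (fun t => 1 - ((t - r ^+ 2) / r) ^+ 2)).
  exact: is_derive_sqr_maxr0.
have -> : (fun t : R => 1 - ((t - r ^+ 2) / r) ^+ 2) =
   cst 1 - (r^-1 *: (id - cst (r ^+ 2))) ^+ 2.
  by apply/funext => u /=; rewrite /GRing.scale/= mulrC.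
apply: is_derive_eq.
by rewrite /= !fctE /GRing.scale/=; ring.
Qed.

Lemma continuous_bump_profile' r : continuous (bump_profile' r).
Proof.
have cu : continuous (fun t : R => (t - r ^+ 2) / r).
  move=> t; apply: cvgM; last exact: cvg_cst.
  by apply: cvgB; [exact: cvg_id|exact: cvg_cst].
move=> t; apply: cvgM; last first.
  apply: cvgN; apply: cvgM; last exact: cvg_cst.
  by apply: cvgM; [exact: cvg_cst|exact: cu].
apply: cvgM; first exact: cvg_cst.
apply: (@continuous_comp _ _ _ (fun t => 1 - ((t - r ^+ 2) / r) ^+ 2)
  (fun t => Num.max 0 t)); last exact: continuous_maxr0.
apply: cvgB; first exact: cvg_cst.
by apply: cvgM; exact: cu.
Qed.

Section dimension.
Variable d : nat.
Implicit Types x y : 'rV[R]_d.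

Lemma sqnormE : @sqnorm R d = \sum_(i < d) (fun x => x ord0 i) ^+ 2.
Proof. by apply/funext => x; rewrite fct_sumE. Qed.

Lemma differentiable_sqnorm x : differentiable (@sqnorm R d) x.
Proof.
rewrite sqnormE; apply: differentiable_sum => i.
by apply: differentiableX; exact: differentiable_coord.
Qed.

Lemma is_derive_coord x v i : is_derive x v (fun x => x ord0 i) (v ord0 i).
Proof.
have H : h^-1 *: ((h *: v + x) ord0 i - x ord0 i) @[h --> (0:R)^'] --> v ord0 i.
  apply: cvg_near_cst; near=> h.
  have h0 : h != 0 by near: h; exact: nbhs_dnbhs_neq.
  by rewrite !mxE addrK /GRing.scale/= mulKf.
split; first by apply/cvg_ex; exists (v ord0 i).
exact: cvg_lim H.
Unshelve. all: by end_near. Qed.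

Lemma derive_sqnorm x i : 'D_(delta_mx ord0 i) (@sqnorm R d) x = 2 * x ord0 i.
Proof.
rewrite sqnormE.
have D j := is_derive_coord x (delta_mx ord0 i) j.
rewrite derive_val (bigD1 i)//= big1 ?addr0.
  by rewrite mxE !eqxx /GRing.scale/= expr1 mulr1.
by move=> j /negbTE ji; rewrite mxE ji andbF scaler0.
Qed.

Definition shell_bump (r : R) x : R := bump_profile r (sqnorm x).

Lemma differentiable_bump r x : differentiable (shell_bump r) x.
Proof.
apply: (@differentiable_comp _ _ _ _ (@sqnorm R d) (bump_profile r)).
  exact: differentiable_sqnorm.
by apply/derivable1_diffP; have [] := is_derive_bump_profile r (sqnorm x).
Qed.

Lemma derive_bump r x i :
  'D_(delta_mx ord0 i) (shell_bump r) x = bump_profile' r (sqnorm x) * (2 * x ord0 i).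
Proof.
have [dp p'] := is_derive_bump_profile r (sqnorm x).
rewrite deriveE; last exact: differentiable_bump.
rewrite (@diff_comp _ _ _ _ (@sqnorm R d) (bump_profile r)); last 2 first.
  exact: differentiable_sqnorm.
  exact/derivable1_diffP.
have := deriveE (delta_mx ord0 i) (differentiable_sqnorm x).
rewrite derive_sqnorm /= => <-; rewrite diff1E; last exact/derivable1_diffP.
by rewrite derive1E p' /GRing.scale/= mulrC.
Qed.

Lemma radial_bump r : radial (@shell_bump r).
Proof.
move=> x y; rewrite /enorm /shell_bump => xy; congr bump_profile.
by rewrite -[LHS]sqr_sqrtr ?sqnorm_ge0// xy sqr_sqrtr ?sqnorm_ge0.
Qed.

Lemma continuous_sqnorm : continuous (@sqnorm R d).
Proof. by move=> x; apply: differentiable_continuous; exact: differentiable_sqnorm. Qed.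

Lemma continuous_gradient_bump r : continuous (gradient (@shell_bump r)).
Proof.
move=> x.
apply: (proj2 (@cvgrPdist_le _ _ _ _ (nbhs_filter x) (gradient (shell_bump r)) (gradient (shell_bump r) x))) => e e0.
have ci i : continuous (fun y : 'rV[R]_d => gradient (shell_bump r) y ord0 i).
  have -> : (fun y : 'rV[R]_d => gradient (shell_bump r) y ord0 i) =
      (fun y => bump_profile' r (sqnorm y) * (2 * y ord0 i)).
    by apply/funext => y; rewrite mxE derive_bump.
  have c1 : continuous (bump_profile' r \o @sqnorm R d).
    move=> y; apply: continuous_comp; first exact: continuous_sqnorm.
    exact: continuous_bump_profile'.
  move=> y; apply: (@continuousM R _ (bump_profile' r \o @sqnorm R d)); first exact: c1.
  apply: (@continuousM R _ (cst 2)); first exact: cst_continuous.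
  exact: coord_continuous.
have : \forall y \near x, forall i, `|gradient (shell_bump r) x ord0 i - gradient (shell_bump r) y ord0 i| <= e.
  apply: (@filter_forall _ _ _ _ (nbhs_filter x)) => i; 
  exact: (proj1 (@cvgrPdist_le _ _ _ _ (nbhs_filter x) _ _) (ci i x) e e0).
apply: filterS => y H; apply/norm_rV_leP; first exact: ltW.
by move=> i; have := H i; rewrite !mxE.
Qed.

Lemma shell_bump_neq0 r x : 0 < r -> shell_bump r x != 0 -> shell r r x.
Proof.
move=> r0; rewrite /shell_bump /bump_profile /shell/=; set u := (_ / r).
case: (leP 0 (1 - u ^+ 2)) => u1; last by rewrite expr0n eqxx.
move=> _; have -> : sqnorm x - r ^+ 2 = u * r by rewrite /u divfK// gt_eqF.
rewrite normrM (gtr0_norm r0) ler_piMl ?(ltW r0)//.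
rewrite -(@ler_pXn2r _ 2)// ?nnegrE// expr1n real_normK ?num_real//; lra.
Qed.

Lemma compactly_supported_bump r : 1 <= r -> compactly_supported (@shell_bump r).
Proof.
move=> r1; have r0 : 0 < r by lra.
have cS : closed (@shell R d r r).
  rewrite (_ : shell r r = @sqnorm R d @^-1` `[r ^+ 2 - r, r ^+ 2 + r]%classic).
    by apply: closed_comp => [x _|]; [exact: continuous_sqnorm|exact: itv_closed].
  by apply/seteqP; split=> x /=; rewrite /shell/= in_itv/= ler_distl.
have bS : bounded_set (@shell R d r r).
  exists (2 * r); split; first exact: num_real.
  move=> M rM x Sx; apply: (@le_trans _ _ (2 * r)); last exact: ltW.
  by apply/norm_rV_leP => [|i]; [lra|exact: shell_coord_le].
apply: (@subclosed_compact _ _ _ _ (bounded_closed_compact bS cS)).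
  exact: closed_closure.
by rewrite closureE; apply: smallest_sub => // x; exact: shell_bump_neq0.
Qed.

Lemma C1c_rad_bump r : 1 <= r -> C1c_rad (@shell_bump r).
Proof.
move=> r1; split; first exact: radial_bump.
  by split; [exact: differentiable_bump|exact: continuous_gradient_bump].
exact: compactly_supported_bump.
Qed.

Lemma shell_bump_ge0 r x : 0 <= shell_bump r x.
Proof. exact: sqr_ge0. Qed.

Lemma shell_bump_le1 r x : shell_bump r x <= 1.
Proof.
rewrite /shell_bump /bump_profile exprn_ile1//; first by rewrite le_max lexx.
rewrite ge_max ler01/= lerBlDr lerDl; exact: sqr_ge0.
Qed.

Lemma shell_bump_ge r x : 0 < r -> shell r (r / 2) x -> 2^-1 <= shell_bump r x.
Proof.
move=> r0; rewrite /shell_bump /bump_profile /shell/=; set u := (_ / r).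
have -> : sqnorm x - r ^+ 2 = u * r by rewrite /u divfK// gt_eqF.
rewrite normrM (gtr0_norm r0) mulrC ler_pM2l// => u1.
have u2 : u ^+ 2 <= 4^-1.
  rewrite -real_normK ?num_real//.
  by have := normr_ge0 u; nra.
have w : 3 / 4 <= Num.max 0 (1 - u ^+ 2) by rewrite le_max; apply/orP; right; lra.
nra.
Qed.

(** The derivative of the profile is of order [1 / r] and that of the squared norm of order [r] on
    the shell; the two powers cancel, so the bound is uniform in [r]. *)
Lemma gradient_bump_coord_le r x i : 1 <= r -> `|gradient (shell_bump r) x ord0 i| <= 16.
Proof.
move=> r1; have r0 : 0 < r by lra.
rewrite mxE derive_bump /bump_profile'; set u := (_ / r).
have [u1|u1] := leP 0 (1 - u ^+ 2); last first.
  by rewrite mulr0 mul0r mul0r normr0.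
have nu : `|u| <= 1.
  by rewrite -(@ler_pXn2r _ 2)// ?nnegrE// expr1n real_normK ?num_real//; lra.
have xr : `|x ord0 i| <= 2 * r.
  apply: shell_coord_le => //; rewrite /shell/=.
  have -> : sqnorm x - r ^+ 2 = u * r by rewrite /u divfK// gt_eqF.
  by rewrite normrM (gtr0_norm r0) ler_piMl ?(ltW r0)//.
have -> : 2 * (1 - u ^+ 2) * - (2 * u / r) * (2 * x ord0 i) =
  - 8 * (1 - u ^+ 2) * u * (x ord0 i / r) by field; rewrite gt_eqF.
have xr' : `|x ord0 i / r| <= 2 by rewrite normrM normfV (gtr0_norm r0) ler_pdivrMr.
move: xr'; set z := _ / r => z2; clearbody u z.
rewrite !normrM normrN (ger0_norm u1) (ger0_norm (ler0n _ 8)).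
have e1 : 1 - u ^+ 2 <= 1 by have := sqr_ge0 u; lra.
have -> : 16 = 8 * 1 * 1 * 2 :> R by lra.
apply: ler_pM => //; first by rewrite !mulr_ge0.
by apply: ler_pM => //; rewrite ?mulr_ge0 ?ler_pM.
Qed.

Lemma gradient_bump_eq0 r x : 0 < r -> ~ shell r r x -> gradient (shell_bump r) x = 0.
Proof.
move=> r0 nS; apply/rowP => i; rewrite !mxE derive_bump /bump_profile'.
set u := (_ / r).
have [u1|u1] := leP 0 (1 - u ^+ 2); last by rewrite mulr0 mul0r mul0r.
exfalso; apply: nS; rewrite /shell/=.
have -> : sqnorm x - r ^+ 2 = u * r by rewrite /u divfK// gt_eqF.
rewrite normrM (gtr0_norm r0) ler_piMl ?(ltW r0)//.
by rewrite -(@ler_pXn2r _ 2)// ?nnegrE// expr1n real_normK ?num_real//; lra.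
Qed.

End dimension.

(** The positive part is 1-Lipschitz, and the sum of the two positive parts is at most 2. *)
Lemma sqr_maxr0_lip (a b : R) : a <= 1 -> b <= 1 ->
  `|Num.max 0 a ^+ 2 - Num.max 0 b ^+ 2| <= 2 * `|a - b|.
Proof.
move=> a1 b1; have lip : `|Num.max 0 a - Num.max 0 b| <= `|a - b|.
  rewrite ler_norml; have := ler_norm (a - b); have := ler_norm (- (a - b)).
  rewrite normrN.
  by case: (leP 0 a) => ?; case: (leP 0 b) => ? ? ?; apply/andP; split; lra.
rewrite subr_sqr normrM mulrC ler_pM//.
by rewrite ger0_norm; case: (leP 0 a) => ?; case: (leP 0 b) => ?; lra.
Qed.

(** Independent of [r]. For the rescaled squared norms [u], [v] of the two points, [5 * d] is the
    Lipschitz constant of [u - v], [2 + 5 * d] bounds [|u + v|], and a factor 2 comes from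
    [sqr_maxr0_lip]. *)
Definition bump_lip d : R := 10 * d%:R * (2 + 5 * d%:R).

Lemma shell_bump_lipschitz_left d r (x y : 'rV[R]_d) : 1 <= r -> shell r r x -> `|x - y| <= 1 ->
  `|shell_bump r x - shell_bump r y| <= bump_lip d * `|x - y|.
Proof.
move=> r1 Sx xy1; have r0 : 0 < r by lra.
set m := `|x - y| in xy1 *.
have m0 : 0 <= m by exact: normr_ge0.
rewrite /shell_bump /bump_profile.
set u := (sqnorm x - _) / r; set v := (sqnorm y - _) / r.
have uv : `|u - v| <= 5 * d%:R * m.
  have -> : u - v = (\sum_(i < d) (x ord0 i - y ord0 i) * (x ord0 i + y ord0 i)) / r.
    rewrite /u /v -mulrBl opprB addrA subrK /sqnorm -sumrB; congr (_ / r).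
    by apply: eq_bigr => i _; rewrite subr_sqr.
  rewrite normrM normfV (gtr0_norm r0) ler_pdivrMr//.
  apply: le_trans (ler_norm_sum _ _ _) _.
  rewrite (_ : 5 * d%:R * m * r = \sum_(i < d) (m * (5 * r))); last first.
    by rewrite sumr_const card_ord -[RHS]mulr_natl; ring.
  apply: ler_sum => i _; rewrite normrM ler_pM//.
    by have := norm_rV_coord (x - y) i; rewrite !mxE.
  have xi := shell_coord_le i r1 Sx.
  have yi : `|x ord0 i - y ord0 i| <= 1.
    by apply: le_trans xy1; have := norm_rV_coord (x - y) i; rewrite !mxE.
  (* Only [x] is known to lie in the shell: this form gives [4 * r + 1 <= 5 * r], and the factor [r]
     cancels the division in [u - v]. *)
  have -> : x ord0 i + y ord0 i = 2 * x ord0 i - (x ord0 i - y ord0 i) by ring.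
  apply: le_trans (ler_normB _ _) _; rewrite normrM ger0_norm//; lra.
have u1 : `|u| <= 1.
  by rewrite /u normrM normfV (gtr0_norm r0) ler_pdivrMr// mul1r.
have v1 : `|v + u| <= 2 + 5 * d%:R.
  have -> : v + u = 2 * u - (u - v) by ring.
  apply: le_trans (ler_normB _ _) _; rewrite normrM (ger0_norm (ler0n _ 2)).
  have : 5 * d%:R * m <= 5 * d%:R by rewrite ler_piMr// mulr_ge0.
  lra.
apply: le_trans (sqr_maxr0_lip _ _) _; rewrite ?lerBlDr ?lerDl ?sqr_ge0//.
have -> : 1 - u ^+ 2 - (1 - v ^+ 2) = (v - u) * (v + u) by ring.
rewrite /bump_lip normrM distrC.
have -> : 10 * d%:R * (2 + 5 * d%:R) * m = 2 * ((5 * d%:R * m) * (2 + 5 * d%:R)) by ring.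
by rewrite ler_pM2l// ler_pM.
Qed.

Lemma shell_bump_lipschitz d r (x y : 'rV[R]_d) : 1 <= r -> shell r r x \/ shell r r y ->
  `|x - y| <= 1 -> `|shell_bump r x - shell_bump r y| <= bump_lip d * `|x - y|.
Proof.
move=> r1 [Sx|Sy] xy; first exact: shell_bump_lipschitz_left.
by rewrite distrC [`|x - y|]distrC shell_bump_lipschitz_left// distrC.
Qed.

End shell_bump.

(** * Energy estimates *)

Section real_powers.
Context {R : realType}.

Lemma powR_exprn (a b : R) k : 0 <= a -> (a ^+ k) `^ b = (a `^ b) ^+ k.
Proof.
move=> a0; elim: k => [|k IH]; first by rewrite !expr0 powR1.
by rewrite !exprS powRM ?exprn_ge0// IH.
Qed.

Lemma powR_half_lt1 (e : R) : 0 < e -> 0 <= 2^-1 `^ e < 1.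
Proof.
move=> e0; have e1 : 1 `^ e = 1 :> R by rewrite powR1.
rewrite powR_ge0/= -[ltRHS]e1 gt0_ltr_powR ?nnegrE//; lra.
Qed.

Lemma nneseries_geometric_le (u : nat -> \bar R) (A z : R) : 0 <= A -> 0 <= z < 1 ->
  (forall k, 0 <= u k)%E -> (forall k, u k <= (A * z ^+ k)%:E)%E ->
  (\sum_(k <oo) u k <= (A / (1 - z))%:E)%E.
Proof.
move=> A0 /andP[z0 z1] u0 uA.
apply: (@le_trans _ _ (\sum_(k <oo) (A * z ^+ k)%:E)%E).
  by apply: lee_nneseries => k *; [exact: u0|exact: uA].
rewrite le_eqVlt; apply/orP; left; apply/eqP.
have cz : series (geometric A z) @ \oo --> A / (1 - z).
  by apply: cvg_geometric_series; rewrite ger0_norm.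
rewrite (_ : (fun n => \sum_(0 <= k < n) (A * z ^+ k)%:E)%E = EFin \o series (geometric A z)).
  by apply/cvg_lim => //; apply: cvg_EFin; [exact: nearW|].
by apply/funext => n; rewrite /= sumEFin.
Qed.

(** Bernoulli's inequality is itself only linear, so it is squared: [B ^+ (2 * n)] is at least
    [(n * h)^2], which exceeds [K * (2 * n + 1)] once [n * h^2 > 3 * K]. *)
Lemma exp_not_linear (B K : R) : 1 < B ->
  ~ forall n, (0 < n)%N -> B ^+ n <= K * n.+1%:R.
Proof.
move=> B1 H; pose h := B - 1; have h0 : 0 < h by rewrite subr_gt0.
have bern n : 1 + n%:R * h <= B ^+ n.
  elim: n => [|n IH]; first by rewrite mul0r addr0 expr0.
  rewrite exprS; apply: (@le_trans _ _ (B * (1 + n%:R * h))); last by rewrite ler_pM2l//; lra.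
  have -> : B = 1 + h by rewrite /h; ring.
  by rewrite -natr1; have := ler0n R n; nra.
have K0 : 0 < K.
  by have := H 1%N isT; rewrite expr1 => ?; nra.
pose n := (Num.truncn (3 * K / h ^+ 2)).+1.
have nK : 3 * K / h ^+ 2 < n%:R by exact: truncnS_gt.
have n1 : 1 <= n%:R :> R by rewrite ler1n.
move: nK; rewrite ltr_pdivrMr ?exprn_gt0// => nK.
have := H (2 * n)%N isT; rewrite mulnC exprM -natr1 natrM.
have : (n%:R * h) ^+ 2 <= (B ^+ n) ^+ 2.
  by rewrite ler_sqr ?nnegrE; have := bern n; nra.
rewrite exprMn; nra.
Qed.

End real_powers.

(** * Coulomb energy of the test functions *)

Section bump_estimates.
Context {R : realType} (d : nat).
Local Notation E := ('rV[R]_d.+1).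
Local Notation mu := (lebesgue_rV (R:=R) d.+1).
Local Notation S r := (@shell R d.+1 r r).

(* Cubes are half-open, hence the side 4 e instead of 2 e. *)
Lemma norm_sub_cube (x y : E) (e : R) : 0 < e -> `|x - y| <= e ->
  cube (x - const_mx (2 * e)) (4 * e) y.
Proof.
move=> e0 xy i; rewrite !mxE in_itv/=.
have := le_trans (norm_rV_coord (x - y) i) xy.
by rewrite !mxE ler_norml => /andP[? ?]; apply/andP; split; lra.
Qed.

Lemma le_lebesgue_rV (A B : set E) : measurable A -> measurable B -> A `<=` B ->
  (mu A <= mu B)%E.
Proof. by move=> mA mB AB; apply: le_measure => //; rewrite inE. Qed.

Lemma xsection_band_le (B : set (E * E)) (e : R) x : measurable B -> 0 < e ->
  B `<=` band e -> (mu (xsection B x) <= ((4 * e) ^+ d.+1)%:E)%E.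
Proof.
move=> mB e0 Be; rewrite -(@lebesgue_rV_cube _ _ (x - const_mx (2 * e))); last by lra.
apply: le_lebesgue_rV; [exact: measurable_xsection|exact: measurable_cube|].
by move=> y; rewrite /xsection/= inE => /Be; exact: norm_sub_cube.
Qed.

Lemma ysection_band_le (B : set (E * E)) (e : R) y : measurable B -> 0 < e ->
  B `<=` band e -> (mu (ysection B y) <= ((4 * e) ^+ d.+1)%:E)%E.
Proof.
move=> mB e0 Be; rewrite -(@lebesgue_rV_cube _ _ (y - const_mx (2 * e))); last by lra.
apply: le_lebesgue_rV; [exact: measurable_ysection|exact: measurable_cube|].
move=> x; rewrite /ysection/= inE => /Be; rewrite /band/= distrC; exact: norm_sub_cube.
Qed.

Definition shell_cst : R := 8 * d.+1%:R ^+ 2 * 8 ^+ d.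

Lemma shell_cst_ge0 : 0 <= shell_cst.
Proof. by rewrite !mulr_ge0 ?exprn_ge0. Qed.

Lemma mul_shell_measure_le (v r : R) : 0 <= v -> 2 <= r ->
  (v%:E * mu (S r) <= (v * (shell_cst * r ^+ d))%:E)%E.
Proof.
by move=> v0 r2; rewrite EFinM lee_wpmul2l ?lee_fin// shell_measure_le.
Qed.

(** Forgets that the second point lies in the shell; this is the better bound for small [e]. *)
Lemma band_shellX_le (r e : R) : 2 <= r -> 0 < e ->
  ((mu \x mu) ((S r `*` S r) `&` band e) <=
    ((4 * e) ^+ d.+1 * (shell_cst * r ^+ d))%:E)%E.
Proof.
move=> r2 e0; apply: le_trans (mul_shell_measure_le _ r2); last first.
  by rewrite exprn_ge0//; lra.
have mS := @measurable_shell R d.+1 r r.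
have mB : measurable ((S r `*` S r) `&` band e).
  by apply: measurableI; [exact: measurableX|exact: measurable_band].
apply: product_lebesgue_le1 => //.
- by rewrite exprn_ge0//; lra.
- by move=> x y [[]].
- by move=> x _; apply: xsection_band_le => // z [].
Qed.

(** Keeps both points in the shell and saves one power of [e], the gain needed at large
    distances. *)
Lemma far_shellX_le (r e : R) : 2 <= r -> 0 < e ->
  ((mu \x mu) ((S r `*` S r) `&` band e) <=
    (8 * d.+1%:R ^+ 2 * (4 * e) ^+ d * (shell_cst * r ^+ d))%:E)%E.
Proof.
move=> r2 e0; have v0 : 0 <= 8 * d.+1%:R ^+ 2 * (4 * e) ^+ d.
  by rewrite !mulr_ge0// ?exprn_ge0//; lra.
apply: le_trans (mul_shell_measure_le v0 r2).
have mS := @measurable_shell R d.+1 r r.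
have mB : measurable ((S r `*` S r) `&` band e).
  by apply: measurableI; [exact: measurableX|exact: measurable_band].
apply: product_lebesgue_le1 => //; first by move=> x y [[]].
move=> x _; have l0 : 0 <= 4 * e by lra.
apply: le_trans (shell_cube_measure (x - const_mx (2 * e)) r2 l0).
apply: le_lebesgue_rV; first exact: measurable_xsection.
  by apply: measurableI; [exact: measurable_shell|exact: measurable_cube].
by move=> y; rewrite /xsection/= inE => -[[_ Sy]]; split=> //; exact: norm_sub_cube.
Qed.

(** For differences of test functions, which can be nonzero as soon as one of the two points is in
    the shell. *)
Lemma band_shellU_le (r e : R) : 2 <= r -> 0 < e ->
  ((mu \x mu) (((S r `*` setT) `|` (setT `*` S r)) `&` band e) <=
    (2 * (4 * e) ^+ d.+1 * (shell_cst * r ^+ d))%:E)%E.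
Proof.
move=> r2 e0; have v0 : 0 <= (4 * e) ^+ d.+1 by rewrite exprn_ge0//; lra.
have mS := @measurable_shell R d.+1 r r.
have mb : measurable (@band R d.+1 e) by exact: measurable_band.
have m1 : measurable ((S r `*` setT) `&` @band R d.+1 e).
  by apply: measurableI => //; exact: measurableX.
have m2 : measurable ((setT `*` S r) `&` @band R d.+1 e).
  by apply: measurableI => //; exact: measurableX.
rewrite setIUl; apply: le_trans (measureU2 _ m1 m2) _.
rewrite -mulrA mulr_natl mulr2n EFinD; apply: leeD;
  apply: le_trans (mul_shell_measure_le v0 r2).
  apply: product_lebesgue_le1 => //; first by move=> x y [[]].
  by move=> x _; apply: xsection_band_le => // z [].
apply: product_lebesgue_le2 => //; first by move=> x y [[]].
by move=> x _; apply: ysection_band_le => // z [].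
Qed.

Lemma shell_norm_le (r : R) (x y : E) : 1 <= r -> S r x -> S r y -> `|x - y| <= 4 * r.
Proof.
move=> r1 Sx Sy; apply/norm_rV_leP => [|i]; first lra.
rewrite !mxE; apply: le_trans (ler_normB _ _) _.
have := shell_coord_le i r1 Sx; have := shell_coord_le i r1 Sy; lra.
Qed.

Lemma powR_enorm_inv_le (e b : R) (x y : E) : 0 < e -> 0 <= b -> e <= `|x - y| ->
  (enorm (x - y) `^ b)^-1 <= (e `^ b)^-1.
Proof.
move=> e0 b0 exy; have exy' := le_trans exy (norm_le_enorm (x - y)).
rewrite lef_pV2 ?posrE ?powR_gt0//; last exact: lt_le_trans exy'.
by rewrite ge0_ler_powR// nnegrE; [exact: ltW|exact: sqrtr_ge0].
Qed.

(** On the diagonal the kernel is the inverse of 0, that is 0, so the diagonal escapes the dyadic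
    decomposition harmlessly. *)
Lemma enorm_powR_neq0 (b : R) (x y : E) : b != 0 -> (enorm (x - y) `^ b)^-1 != 0 -> x != y.
Proof.
move=> b0; apply: contra_neq => ->; rewrite subrr /enorm big1 ?sqrtr0 ?powR0 ?invr0//.
by move=> i _; rewrite mxE expr0n.
Qed.

Lemma coulomb_energy_bump_le (alpha q : R) : (0 < d)%N -> 0 < alpha <= 1 -> 1 <= q ->
  exists2 C : R, 0 < C & forall n, (0 < n)%N ->
    (coulomb_energy alpha q (@shell_bump R d.+1 (2 ^+ n)) <=
      (C * n.+1%:R * (2 ^+ n) ^+ d)%:E)%E.
Proof.
move=> d0 /andP[al0 al1] q1.
pose b := d.+1%:R - alpha.
have d1 : 1 <= d%:R :> R by rewrite ler1n.
have b0 : 0 < b by rewrite /b -natr1; lra.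
have bd : d%:R <= b by rewrite /b -natr1; lra.
pose h : R := 2^-1.
have h0 : 0 < h by rewrite invr_gt0.
pose K1 := (h `^ b)^-1 * 4 ^+ d.+1 / (1 - h `^ alpha) * shell_cst.
pose K2 := 8 * d.+1%:R ^+ 2 * 8 ^+ d * shell_cst.
have hz := powR_half_lt1 al0.
have K10 : 0 <= K1.
  rewrite mulr_ge0 ?shell_cst_ge0// divr_ge0//; last by move: hz => /andP[]; rewrite -/h; lra.
  by rewrite mulr_ge0 ?invr_ge0 ?powR_ge0.
have K20 : 0 <= K2 by rewrite !mulr_ge0 ?shell_cst_ge0 ?exprn_ge0.
(* [K1] serves the near scales and [K2] each far one, with [n + 3 <= 3 * n.+1]; the summand 1
   ensures positivity. *)
exists (1 + K1 + 3 * K2); first lra.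
move=> n n0; set r : R := 2 ^+ n.
have r2 : 2 <= r by rewrite /r -(prednK n0) exprS ler_peMr// exprn_ege1//; lra.
have r1 : 1 <= r by lra.
have r0 : 0 < r by lra.
pose a k := ((h ^+ k.+1) `^ b)^-1.
(* Two points of the shell are at distance at most [4 * r = 2 ^+ (n + 2)], so later scales are
   empty. *)
pose c k := if (k < n + 3)%N then ((2 ^+ k : R) `^ b)^-1 else 0.
have m0 : 0 <= shell_cst * r ^+ d by rewrite mulr_ge0 ?shell_cst_ge0 ?exprn_ge0//; lra.
have mS := @measurable_shell R d.+1 r r.
rewrite /coulomb_energy.
have gq1 (x : E) : 0 <= `|shell_bump r x| `^ q <= 1.
  have e1 : 1 `^ q = 1 :> R by rewrite powR1.
  rewrite powR_ge0/= -[leRHS]e1 ge0_ler_powR ?nnegrE//; first lra.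
  by rewrite ger0_norm ?shell_bump_le1 ?shell_bump_ge0.
have gqS (x : E) : `|shell_bump r x| `^ q != 0 -> S r x.
  rewrite powR_eq0 negb_and => /orP[|/negP[]]; last by apply/eqP; lra.
  by rewrite normr_eq0; exact: shell_bump_neq0.
have Hle (x y : E) (e : R) : 0 < e -> e <= `|x - y| ->
    `|shell_bump r x| `^ q * `|shell_bump r y| `^ q / enorm (x - y) `^ b <= (e `^ b)^-1.
  move=> e0 exy; apply: le_trans (powR_enorm_inv_le e0 (ltW b0) exy).
  rewrite ler_piMl ?invr_ge0 ?powR_ge0//.
  by have /andP[? ?] := gq1 x; have /andP[? ?] := gq1 y; rewrite mulr_ile1.
apply: le_trans (double_integral_dyadic (D := S r `*` S r) (a := a) (b := c) _ _ _ _ _ _ _) _.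
- exact: measurableX.
- by move=> x y; rewrite !mulr_ge0 ?powR_ge0 ?invr_ge0 ?powR_ge0.
- by move=> k; rewrite invr_ge0 powR_ge0.
- by move=> k; rewrite /c; case: ifP => // _; rewrite invr_ge0 powR_ge0.
- move=> x y; rewrite !mulf_eq0 !negb_or => /andP[/andP[gx gy] xy].
  by split; [apply: enorm_powR_neq0 xy; rewrite gt_eqF|split; exact: gqS].
- by move=> k x y _ /andP[xy _]; apply: Hle => //; exact: exprn_gt0.
- move=> k x y [Sx Sy] /andP[xy _]; rewrite /c.
  case: ltnP => kn; first by apply: Hle => //; exact: exprn_gt0.
  have : (2 : R) ^+ k <= 2 ^+ (n + 2).
    apply: le_trans xy _; apply: le_trans (shell_norm_le r1 Sx Sy) _.
    by rewrite exprD -/r mulrC; lra.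
  rewrite ler_eXn2l//; last lra.
  by rewrite leqNgt -addnS kn.
have near_le : (\sum_(k <oo) (a k)%:E * (mu \x mu) ((S r `*` S r) `&` band (2^-1 ^+ k)) <=
    (K1 * r ^+ d)%:E)%E.
  rewrite (_ : K1 * r ^+ d = (h `^ b)^-1 * 4 ^+ d.+1 * (shell_cst * r ^+ d) / (1 - h `^ alpha)); last first.
    by rewrite /K1; ring.
  apply: nneseries_geometric_le => //.
  - by rewrite !mulr_ge0 ?invr_ge0 ?powR_ge0 ?shell_cst_ge0 ?exprn_ge0//; lra.
  - by move=> k; rewrite mule_ge0// lee_fin invr_ge0 powR_ge0.
  - move=> k; apply: (@le_trans _ _ ((a k)%:E * ((4 * h ^+ k) ^+ d.+1 * (shell_cst * r ^+ d))%:E)%E).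
      by rewrite lee_wpmul2l ?lee_fin ?invr_ge0 ?powR_ge0// band_shellX_le// exprn_gt0.
    rewrite -EFinM lee_fin /a powR_exprn ?(ltW h0)// exprS invfM.
    (* The ratio of the geometric series is volume over kernel at scale [h]. *)
    have -> : h `^ alpha = h ^+ d.+1 / h `^ b.
      rewrite /b -powR_mulrn ?(ltW h0)// -powRB; last by apply/implyP => _; rewrite gt_eqF.
      by congr (_ `^ _); ring.
    rewrite expr_div_n exprMn [(h ^+ k) ^+ _]exprAC.
    rewrite le_eqVlt; apply/orP; left; apply/eqP.
    by ring.
have far_le : (\sum_(k <oo) (c k)%:E * (mu \x mu) ((S r `*` S r) `&` band (2 ^+ k.+1)) <=
    ((n + 3)%:R * (K2 * r ^+ d))%:E)%E.
  rewrite (@nneseries_split _ _ 0 (n + 3)%N); last first.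
    by move=> k _; rewrite mule_ge0// lee_fin /c; case: ifP => // _; rewrite invr_ge0 powR_ge0.
  rewrite add0n eseries0 ?adde0; last first.
    by move=> k kn _; rewrite /c ltnNge kn/= mul0e.
  rewrite big_mkord (_ : (n + 3)%:R * _ = \sum_(k < n + 3) (K2 * r ^+ d)); last first.
    by rewrite sumr_const card_ord mulr_natl.
  rewrite -sumEFin; apply: lee_sum => k _; rewrite /c ltn_ord.
  have e0 : 0 < 2 ^+ k.+1 :> R by exact: exprn_gt0.
  apply: (@le_trans _ _ (((2 ^+ k : R) `^ b)^-1%:E *
     (8 * d.+1%:R ^+ 2 * (4 * 2 ^+ k.+1) ^+ d * (shell_cst * r ^+ d))%:E)%E).
    by rewrite lee_wpmul2l ?lee_fin ?invr_ge0 ?powR_ge0// far_shellX_le.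
  rewrite -EFinM lee_fin.
  (* Here [alpha <= 1] enters, as [d <= b]: the kernel absorbs the measure of the shell at scale
     [2 ^+ k], and each scale costs at most a constant times [r ^+ d]. *)
  have kb : (2 ^+ k) ^+ d <= (2 ^+ k : R) `^ b.
    rewrite -(powR_mulrn (a := 2 ^+ k)) ?exprn_ge0// ler_powR// exprn_ege1//; lra.
  have -> : (4 * 2 ^+ k.+1 : R) ^+ d = 8 ^+ d * (2 ^+ k) ^+ d.
    by rewrite -exprMn exprS; congr (_ ^+ _); ring.
  rewrite mulrC ler_pdivrMr ?powR_gt0 ?exprn_gt0//.
  rewrite (_ : 8 * _ * _ * _ = K2 * r ^+ d * (2 ^+ k) ^+ d); last by rewrite /K2; ring.
  by rewrite ler_wpM2l// mulr_ge0// exprn_ge0// (ltW r0).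
apply: le_trans (leeD near_le far_le) _.
rewrite -EFinD lee_fin mulrA -mulrDl ler_wpM2r ?exprn_ge0 ?(ltW r0)//.
rewrite natrD -natr1; have := ler0n R n => ?; nra.
Qed.

End bump_estimates.

(** * Sobolev seminorms and L^gamma norm of the test functions *)

Section sobolev_estimates.
Context {R : realType} (d : nat).
Local Notation E := ('rV[R]_d.+1).
Local Notation mu := (lebesgue_rV (R:=R) d.+1).
Local Notation S r := (@shell R d.+1 r r).

(** Below distance 1 the Lipschitz bound wins [p] powers of the distance against [s * p], and the
    series converges because [s < 1]; above it the difference is at most 1, and [s > 0] makes the
    kernel summable. *)
Lemma gagliardo_bump_le (s p : R) : 0 < s < 1 -> 1 <= p ->
  exists2 C : R, 0 < C & forall r : R, 2 <= r ->
    (\int[mu]_x \int[mu]_y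
      (`|shell_bump r x - shell_bump r y| `^ p / enorm (x - y) `^ (d.+1%:R + s * p))%:E
     <= (C * r ^+ d)%:E)%E.
Proof.
move=> /andP[s0 s1] p1.
pose b := d.+1%:R + s * p.
have p0 : 0 < p by lra.
have sp0 : 0 < s * p by rewrite mulr_gt0.
have b0 : 0 < b by rewrite /b addr_gt0.
pose h : R := 2^-1.
have h0 : 0 < h by rewrite invr_gt0.
pose L : R := bump_lip d.+1.
have L0 : 0 <= L by rewrite /L /bump_lip !mulr_ge0 ?addr_ge0 ?mulr_ge0.
have nz : 0 <= h `^ (p - s * p) < 1 by apply: powR_half_lt1; nra.
have fz : 0 <= h `^ (s * p) < 1 by exact: powR_half_lt1.
pose A1 := L `^ p * (h `^ b)^-1 * (2 * 4 ^+ d.+1).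
pose A2 : R := 2 * 8 ^+ d.+1.
have A10 : 0 <= A1 by rewrite !mulr_ge0 ?invr_ge0 ?powR_ge0 ?exprn_ge0.
have A20 : 0 <= A2 by rewrite !mulr_ge0 ?exprn_ge0.
pose K1 := A1 / (1 - h `^ (p - s * p)) * shell_cst d.
pose K2 := A2 / (1 - h `^ (s * p)) * shell_cst d.
have K10 : 0 <= K1.
  by rewrite mulr_ge0 ?shell_cst_ge0// divr_ge0//; move: nz => /andP[_]; rewrite subr_ge0 => /ltW.
have K20 : 0 <= K2.
  by rewrite mulr_ge0 ?shell_cst_ge0// divr_ge0//; move: fz => /andP[_]; rewrite subr_ge0 => /ltW.
exists (1 + K1 + K2); first lra.
move=> r r2; have r1 : 1 <= r by lra.
have r0 : 0 < r by lra.
pose a k := (L * h ^+ k) `^ p / (h ^+ k.+1) `^ b.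
pose c k := ((2 ^+ k : R) `^ b)^-1.
have m0 : 0 <= shell_cst d * r ^+ d by rewrite mulr_ge0 ?shell_cst_ge0 ?exprn_ge0//; lra.
have mS := @measurable_shell R d.+1 r r.
apply: le_trans (double_integral_dyadic
  (D := (S r `*` setT) `|` (setT `*` S r)) (a := a) (b := c) _ _ _ _ _ _ _) _.
- by apply: measurableU; exact: measurableX.
- by move=> x y; rewrite mulr_ge0 ?powR_ge0 ?invr_ge0 ?powR_ge0.
- by move=> k; rewrite mulr_ge0 ?powR_ge0 ?invr_ge0 ?powR_ge0.
- by move=> k; rewrite invr_ge0 powR_ge0.
- move=> x y; rewrite mulf_eq0 negb_or => /andP[gxy xy].
  split; first by apply: enorm_powR_neq0 xy; rewrite gt_eqF.
  apply: contrapT => nS; move/negP: gxy; apply.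
  have [gx gy] : shell_bump r x = 0 /\ shell_bump r y = 0.
    by split; apply/eqP; apply: contrapT => /negP /(shell_bump_neq0 r0) ?; apply: nS; [left|right]; split.
  by rewrite gx gy subrr normr0 powR0// gt_eqF.
- move=> k x y D /andP[xy1 xy2].
  have xyl : `|x - y| <= 1 by apply: le_trans xy2 _; rewrite exprn_ile1 ?(ltW h0) ?invf_le1// ler1n.
  rewrite /a; apply: ler_pM; rewrite ?powR_ge0 ?invr_ge0 ?powR_ge0//; last first.
    by apply: powR_enorm_inv_le; rewrite ?exprn_gt0// ltW.
  apply: ge0_ler_powR; rewrite ?nnegrE ?mulr_ge0 ?exprn_ge0 ?(ltW h0) ?(ltW p0)//.
  apply: (@le_trans _ _ (L * `|x - y|)); last by rewrite ler_wpM2l.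
  apply: shell_bump_lipschitz => //.
  by case: D => -[? ?]; [left|right].
- move=> k x y _ /andP[xy _].
  apply: le_trans (powR_enorm_inv_le (exprn_gt0 _ _) (ltW b0) xy) => //.
  rewrite ler_piMl ?invr_ge0 ?powR_ge0//.
  have e1 : 1 `^ p = 1 :> R by rewrite powR1.
  rewrite -[leRHS]e1; apply: ge0_ler_powR; rewrite ?nnegrE ?(ltW p0)//.
  have := shell_bump_ge0 r x; have := shell_bump_ge0 r y; have := shell_bump_le1 r x; have := shell_bump_le1 r y.
  by rewrite ler_norml => *; apply/andP; split; lra.
rewrite -addrA mulrDl mul1r EFinD; apply: le_trans (leeDr _ _); last first.
  by rewrite lee_fin exprn_ge0// (ltW r0).
rewrite mulrDl EFinD; apply: leeD.
  rewrite (_ : K1 * r ^+ d = A1 * (shell_cst d * r ^+ d) / (1 - h `^ (p - s * p))); last first.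
    by rewrite /K1; ring.
  apply: nneseries_geometric_le => //; first by rewrite mulr_ge0.
    by move=> k; rewrite mule_ge0// lee_fin mulr_ge0 ?powR_ge0 ?invr_ge0 ?powR_ge0.
  move=> k; apply: (@le_trans _ _ ((a k)%:E * (2 * (4 * h ^+ k) ^+ d.+1 * (shell_cst d * r ^+ d))%:E)%E).
    rewrite lee_wpmul2l ?lee_fin ?mulr_ge0 ?invr_ge0 ?powR_ge0//.
    by rewrite band_shellU_le// exprn_gt0.
  rewrite -EFinM lee_fin /a powRM ?exprn_ge0 ?(ltW h0)//.
  rewrite !powR_exprn ?(ltW h0)// [_ ^+ k.+1]exprS invfM.
  have -> : h `^ (p - s * p) = h `^ p * h ^+ d.+1 / h `^ b.
    rewrite /b -powR_mulrn ?(ltW h0)// -powRD; last by apply/implyP => _; rewrite gt_eqF.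
    rewrite -powRB; last by apply/implyP => _; rewrite gt_eqF.
    by congr (_ `^ _); ring.
  rewrite expr_div_n !exprMn [(h ^+ k) ^+ _]exprAC.
  rewrite le_eqVlt; apply/orP; left; apply/eqP.
  by rewrite /A1; ring.
rewrite (_ : K2 * r ^+ d = A2 * (shell_cst d * r ^+ d) / (1 - h `^ (s * p))); last first.
  by rewrite /K2; ring.
apply: nneseries_geometric_le => //; first by rewrite mulr_ge0.
  by move=> k; rewrite mule_ge0// lee_fin invr_ge0 powR_ge0.
move=> k; apply: (@le_trans _ _ ((c k)%:E * (2 * (4 * 2 ^+ k.+1) ^+ d.+1 * (shell_cst d * r ^+ d))%:E)%E).
  rewrite lee_wpmul2l ?lee_fin ?invr_ge0 ?powR_ge0//.
  by rewrite band_shellU_le// exprn_gt0.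
rewrite -EFinM lee_fin /c powR_exprn//.
have -> : h `^ (s * p) = 2 ^+ d.+1 / 2 `^ b.
  rewrite /b powRD; last by apply/implyP => _; rewrite gt_eqF.
  rewrite powR_mulrn// invfM mulrA divff ?mul1r ?expf_neq0 ?gt_eqF//.
  by rewrite /h -powR_inv1// -powRrM mulN1r powRN.
have -> : (4 * 2 ^+ k.+1 : R) ^+ d.+1 = 8 ^+ d.+1 * (2 ^+ d.+1) ^+ k.
  by rewrite -exprM mulnC exprM -exprMn [2 ^+ k.+1]exprS; congr (_ ^+ _); ring.
rewrite expr_div_n.
rewrite le_eqVlt; apply/orP; left; apply/eqP.
by rewrite /A2; ring.
Qed.

Lemma gradient_bump_integral_le (p : R) : 1 <= p ->
  exists2 C : R, 0 < C & forall r : R, 2 <= r ->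
    (\int[mu]_x (enorm (gradient (shell_bump r) x) `^ p)%:E <= (C * r ^+ d)%:E)%E.
Proof.
move=> p1; pose K := (d.+1%:R * 16 : R) `^ p.
have K0 : 0 < K by rewrite powR_gt0.
exists (K * (1 + shell_cst d)).
  by rewrite mulr_gt0// ltr_wpDr// shell_cst_ge0.
move=> r r2; have r0 : 0 < r by lra.
have mS := @measurable_shell R d.+1 r r.
apply: (@le_trans _ _ (\int[mu]_x (K * \1_(S r) x)%:E)%E).
  apply: le_integral_nonmeas => x; rewrite lee_fin ?powR_ge0// indicE.
  case: (boolP (x \in _)) => [_|/negP].
    rewrite mulr1; apply: ge0_ler_powR; rewrite ?nnegrE ?mulr_ge0 ?sqrtr_ge0//; first lra.
    by apply: enorm_le => // i; apply: gradient_bump_coord_le; lra.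
  rewrite inE => nS; rewrite gradient_bump_eq0// /enorm big1 ?sqrtr0 ?powR0 ?mulr0//.
    by apply/eqP; lra.
  by move=> i _; rewrite mxE expr0n.
rewrite integral_cst_indic ?(ltW K0)//.
apply: le_trans (mul_shell_measure_le d (ltW K0) r2) _.
rewrite lee_fin -mulrA ler_wpM2l ?(ltW K0)// ler_wpM2r ?exprn_ge0 ?(ltW r0)//.
by rewrite lerDr.
Qed.

Lemma sobolev_bump_le (s p : R) : 0 < s <= 1 -> 1 <= p ->
  exists2 C : R, 0 < C & forall r : R, 2 <= r ->
    (sobolev_seminorm s p (@shell_bump R d.+1 r) <= ((C * r ^+ d) `^ p^-1)%:E)%E.
Proof.
move=> /andP[s0 s1] p1; rewrite /sobolev_seminorm.
have pV0 : 0 <= p^-1 by rewrite invr_ge0; lra.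
have root (I : \bar R) (K r : R) : (0 <= I)%E -> 0 < K -> 2 <= r ->
    (I <= (K * r ^+ d)%:E)%E -> (I `^ p^-1 <= ((K * r ^+ d) `^ p^-1)%:E)%E.
  move=> I0 K0 r2 IK; rewrite -poweR_EFin; apply: gt0_ler_poweR => //.
    by rewrite in_itv/= I0 leey.
  rewrite in_itv/= leey andbT lee_fin mulr_ge0 ?(ltW K0) ?exprn_ge0//; lra.
have [_|s1'] := eqVneq s 1.
  have [C C0 HC] := gradient_bump_integral_le p1.
  exists C => // r r2; apply: root => //; last exact: HC.
  by apply: integral_ge0 => x _; rewrite lee_fin powR_ge0.
have s01 : 0 < s < 1 by rewrite s0 lt_neqAle s1' s1.
have [C C0 HC] := gagliardo_bump_le s01 p1.
exists C => // r r2; apply: root => //; last exact: HC.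
apply: integral_ge0 => x _; apply: integral_ge0 => y _.
by rewrite lee_fin mulr_ge0 ?powR_ge0 ?invr_ge0 ?powR_ge0.
Qed.

Lemma Lnorm_bump_ge (gamma : R) : 1 < gamma ->
  exists2 C : R, 0 < C & forall r : R, 2 <= r ->
    (((C * r ^+ d) `^ gamma^-1)%:E <= 'N[mu]_(gamma%:E)[EFin \o shell_bump r])%E.
Proof.
move=> g1; pose K := (2^-1 : R) `^ gamma.
have K0 : 0 < K by rewrite powR_gt0.
pose c : R := 8^-1 * (2 * d.+1%:R) ^- d.
have c0 : 0 < c by rewrite mulr_gt0 ?invr_gt0 ?exprn_gt0 ?mulr_gt0.
exists (K * c) => [|r r2]; first exact: mulr_gt0.
have r0 : 0 < r by lra.
rewrite unlock -poweR_EFin; apply: gt0_ler_poweR.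
- by rewrite invr_ge0; lra.
- by rewrite in_itv/= leey andbT lee_fin mulr_ge0 ?exprn_ge0 ?(ltW r0)// ltW ?mulr_gt0.
- by rewrite in_itv/= leey andbT; apply: integral_ge0 => x _; rewrite lee_fin powR_ge0.
have mA := @measurable_shell R d.+1 r (r / 2).
apply: (@le_trans _ _ (\int[mu]_x (K * \1_(shell r (r / 2)) x)%:E)%E).
  rewrite integral_cst_indic ?(ltW K0)// -mulrA EFinM.
  by rewrite lee_wpmul2l ?lee_fin ?(ltW K0)// shell_measure_ge.
apply: le_integral_nonmeas => x; first by rewrite lee_fin mulr_ge0 ?(ltW K0).
rewrite /= lee_fin indicE.
case: (boolP (x \in _)) => [|_]; last by rewrite mulr0 powR_ge0.
rewrite inE mulr1 => Sx; apply: ge0_ler_powR; rewrite ?nnegrE//; first lra.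
by rewrite (ger0_norm (shell_bump_ge0 _ _)) shell_bump_ge.
Qed.

End sobolev_estimates.

(** * Comparison of growth rates along r = 2^n *)

Theorem theorem1p5 (R : realType) (d : nat)
    (s gamma p q alpha beta1 beta2 : R) :
  (2 <= d)%N ->
  0 < s <= 1 ->
  1 < gamma ->
  1 <= p ->
  1 <= q ->
  0 < alpha <= 1 ->
  0 < beta1 ->
  0 < beta2 ->
  beta1 * p + 2 * beta2 * q = 1 ->
  (d%:R - s * p) * beta1 + (d%:R + alpha) * beta2 = d%:R / gamma ->
  p * (d%:R + alpha) - 2 * q * (d%:R - s * p) != 0 ->
  beta1 * gamma + beta2 * gamma < 1 ->
  ~ exists C : R, 0 < C /\
      forall g : 'rV[R]_d -> R, C1c_rad g ->
        ('N[lebesgue_rV d]_(gamma%:E)[EFin \o g] <=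
         C%:E * sobolev_seminorm s p g `^ (beta1 * p)
              * coulomb_energy alpha q g `^ beta2)%E.
Proof.
case: d => [//|d]; rewrite ltnS => d0 hs hg hp hq ha hb1 hb2 _ _ _ hb [C [C0 HC]].
have [c1 c10 H1] := sobolev_bump_le d hs hp.
have [c2 c20 H2] := coulomb_energy_bump_le d0 ha hq.
have [c3 c30 H3] := Lnorm_bump_ge d hg.
have g0 : 0 < gamma by lra.
have p0 : 0 < p by lra.
(* Excess of the exponent of [r ^+ d] on the left over that on the right; its positivity is the last
   hypothesis divided by [gamma]. *)
pose kappa := gamma^-1 - beta1 - beta2.
have k0 : 0 < kappa.
  rewrite /kappa -addrA -opprD subr_gt0 -(ltr_pM2r g0) mulVf ?gt_eqF//.
  by rewrite mulrDl.
pose B : R := ((2 ^+ d) `^ kappa) `^ beta2^-1.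
have pow_gt1 (x e : R) : 1 < x -> 0 < e -> 1 < x `^ e.
  move=> x1 e0; have e1 : 1 `^ e = 1 :> R by rewrite powR1.
  by rewrite -[ltLHS]e1; apply: gt0_ltr_powR; rewrite ?nnegrE//; lra.
have B1 : 1 < B.
  by apply: (pow_gt1 _ _); rewrite ?invr_gt0//; apply: (pow_gt1 _ _) => //; rewrite exprn_egt1 ?lt0n_neq0//; lra.
pose K := C * c1 `^ beta1 * c2 `^ beta2 / c3 `^ gamma^-1.
have K0 : 0 < K by rewrite !mulr_gt0 ?invr_gt0 ?powR_gt0.
apply: (@exp_not_linear R B (K `^ beta2^-1)) => // n n0.
pose r : R := 2 ^+ n; pose X : R := r ^+ d.
have r2 : 2 <= r by rewrite /r -(prednK n0) exprS ler_peMr// exprn_ege1//; lra.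
have r0 : 0 < r by lra.
have X0 : 0 < X by rewrite exprn_gt0.
have n10 : 0 < n.+1%:R :> R by [].
have main : (c3 * X) `^ gamma^-1 <=
    C * ((c1 * X) `^ beta1) * ((c2 * n.+1%:R * X) `^ beta2).
  have g1c : C1c_rad (@shell_bump R d.+1 r) by apply: C1c_rad_bump; lra.
  rewrite -lee_fin; apply: le_trans (H3 _ r2) _; apply: le_trans (HC _ g1c) _.
  have W0 : (0 <= sobolev_seminorm s p (@shell_bump R d.+1 r))%E.
    by rewrite /sobolev_seminorm; case: ifP => _; exact: poweR_ge0.
  have E0 : (0 <= coulomb_energy alpha q (@shell_bump R d.+1 r))%E.
    apply: integral_ge0 => x _; apply: integral_ge0 => y _.
    by rewrite lee_fin !mulr_ge0 ?powR_ge0 ?invr_ge0 ?powR_ge0.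
  rewrite !EFinM; apply: lee_pmul.
  - by rewrite mule_ge0 ?poweR_ge0// lee_fin ltW.
  - exact: poweR_ge0.
  - rewrite lee_wpmul2l ?lee_fin ?(ltW C0)//.
    (* The seminorm is a [p]-th root, which cancels the [p] in the exponent [beta1 * p]. *)
    have -> : (c1 * X) `^ beta1 = ((c1 * X) `^ p^-1) `^ (beta1 * p).
      by rewrite -powRrM [p^-1 * _]mulrCA mulVf ?mulr1// gt_eqF.
    rewrite -poweR_EFin; apply: gt0_ler_poweR.
    + by rewrite mulr_ge0 ?(ltW hb1) ?(ltW p0).
    + by rewrite in_itv/= W0 leey.
    + by rewrite in_itv/= leey lee_fin powR_ge0.
    + exact: H1.
  - rewrite -poweR_EFin; apply: gt0_ler_poweR.
    + exact: ltW.
    + by rewrite in_itv/= E0 leey.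
    + by rewrite in_itv/= leey lee_fin !mulr_ge0 ?(ltW c20) ?(ltW X0).
    + exact: H2.
have XB : X `^ kappa <= K * n.+1%:R `^ beta2.
  rewrite /kappa -addrA -opprD powRB; last by apply/implyP => _; rewrite gt_eqF.
  rewrite powRD; last by apply/implyP => _; rewrite gt_eqF.
  move: main; rewrite !powRM ?mulr_ge0 ?(ltW c30) ?(ltW c10) ?(ltW c20) ?(ltW X0)// => main.
  rewrite ler_pdivrMr ?mulr_gt0 ?powR_gt0//.
  rewrite -(ler_pM2l (_ : 0 < c3 `^ gamma^-1)) ?powR_gt0//.
  apply: le_trans main _; rewrite le_eqVlt; apply/orP; left; apply/eqP.
  by rewrite /K; field; rewrite gt_eqF ?powR_gt0.
have -> : B ^+ n = (X `^ kappa) `^ beta2^-1.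
  by rewrite /B /X /r exprAC !powR_exprn ?exprn_ge0 ?powR_ge0.
have -> : K `^ beta2^-1 * n.+1%:R = (K * n.+1%:R `^ beta2) `^ beta2^-1.
  by rewrite powRM ?powR_ge0 ?(ltW K0)// -powRrM divff ?gt_eqF// powRr1.
apply: ge0_ler_powR => //; rewrite ?nnegrE ?invr_ge0 ?(ltW hb2) ?powR_ge0//.
by rewrite mulr_ge0 ?powR_ge0 ?(ltW K0).
Qed.
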